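(* Let $\mu$ be an isotropic $1$-unconditional log-concave probability measure on $\mathbb{R}^n$ with continuous density $f$. Then for every convex set $A\subset\mathbb{R}^n$ and every $\epsilon>0$, $$\mu\big((A+\epsilon B_2^n)\setminus A\big)\leq \sqrt{2}\,n\,\epsilon.$$ Consequently $\mu^+(\partial A)\leq\sqrt{2}\,n$ for every convex set $A$, and $\Gamma(\mu)\leq \sqrt{2}\,n$.
   Context: A probability measure on $\mathbb{R}^n$ is log-concave if it has a density $f$ with $\ln f$ concave; isotropic means barycenter $0$ and identity covariance matrix; $1$-unconditional means $f(x_1,\dots,x_n)=f(\epsilon_1x_1,\dots,\epsilon_nx_n)$ for all $\epsilon_i\in\{-1,1\}$. $B_2^n$ is the Euclidean unit ball. $\mu^+(\partial A)=\liminf_{\epsilon\to0^+}\frac{\mu((A+\epsilon B_2^n)\setminus A)}{\epsilon}$ and $\Gamma(\mu)=\sup\{\mu^+(\partial A): A \text{ a convex body (compact convex set with nonempty interior)}\}$. *)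

(* Defs.v *)
From HB Require Import structures.
From mathcomp Require Import all_boot all_order all_algebra.
From mathcomp Require Import all_classical all_reals all_analysis.
Set Implicit Arguments. Unset Strict Implicit. Unset Printing Implicit Defensive.
Import Order.TTheory GRing.Theory Num.Theory.
Import numFieldNormedType.Exports.
Local Open Scope classical_set_scope.
Local Open Scope ring_scope.

Section Defs.
Variable R : realType.

Definition enorm (n : nat) (x : 'rV[R]_n) : R :=
  Num.sqrt (\sum_(i < n) x ord0 i ^+ 2).

Definition eball (n : nat) (eps : R) : set 'rV[R]_n :=
  [set x | enorm x <= eps].

Definition enlarge (n : nat) (A : set 'rV[R]_n) (eps : R) : set 'rV[R]_n :=
  [set a + b | a in A & b in @eball n eps].

Definition convex_subset (n : nat) (A : set 'rV[R]_n) : Prop :=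
  forall x y, A x -> A y -> forall l : R, 0 <= l <= 1 ->
    A ((1 - l) *: x + l *: y).

Definition convex_body (n : nat) (A : set 'rV[R]_n) : Prop :=
  convex_subset A /\ compact A /\ A° !=set0.

Fixpoint iint (k : nat) (g : seq R -> \bar R) : \bar R :=
  match k with
  | 0 => g [::]
  | k'.+1 => (\int[@lebesgue_measure R]_x iint k' (fun s => g (x :: s)))%E
  end.

Definition Rn_int (n : nat) (g : 'rV[R]_n -> \bar R) : \bar R :=
  iint n (fun s => g (\row_(i < n) nth 0 s i)).

Definition dmeasure (n : nat) (f : 'rV[R]_n -> R) (S : set 'rV[R]_n) : \bar R :=
  Rn_int (fun x => (\1_S x * f x)%:E).

Definition prob_density (n : nat) (f : 'rV[R]_n -> R) : Prop :=
  (forall x, 0 <= f x) /\ Rn_int (fun x => (f x)%:E) = 1%E.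

(* ln f concave (with ln 0 = -oo), written multiplicatively. *)
Definition log_concave_fun (n : nat) (f : 'rV[R]_n -> R) : Prop :=
  (forall x, 0 <= f x) /\
  forall x y (l : R), 0 <= l <= 1 ->
    f x `^ (1 - l) * f y `^ l <= f ((1 - l) *: x + l *: y).

Definition isotropic (n : nat) (f : 'rV[R]_n -> R) : Prop :=
  (forall i : 'I_n, Rn_int (fun x : 'rV[R]_n => (x ord0 i * f x)%:E) = 0%E) /\
  (forall i j : 'I_n,
     Rn_int (fun x : 'rV[R]_n => (x ord0 i * x ord0 j * f x)%:E) = ((i == j)%:R)%:E).

Definition unconditional (n : nat) (f : 'rV[R]_n -> R) : Prop :=
  forall (e : 'rV[R]_n), (forall i, e ord0 i = 1 \/ e ord0 i = -1) ->
    forall x : 'rV[R]_n, f (\row_(i < n) (e ord0 i * x ord0 i)) = f x.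

Definition liminf_right0 (g : R -> \bar R) : \bar R :=
  ereal_sup [set ereal_inf [set g e | e in [set e | 0 < e < d]] | d in [set d : R | 0 < d]].

Definition surface_measure (n : nat) (f : 'rV[R]_n -> R) (A : set 'rV[R]_n) : \bar R :=
  liminf_right0 (fun e => (dmeasure f (enlarge A e `\` A) * (e^-1)%:E)%E).

Definition Gamma (n : nat) (f : 'rV[R]_n -> R) : \bar R :=
  ereal_sup [set surface_measure f A | A in [set A | convex_body A]].

End Defs.

(* Main.v *)
Require Import Defs.
From HB Require Import structures.
From mathcomp Require Import all_boot all_order all_algebra.
From mathcomp Require Import all_classical all_reals all_analysis.
From mathcomp Require Import measurable_realfun ring lra.
Import Order.TTheory GRing.Theory Num.Theory.
Import numFieldNormedType.Exports.
Local Open Scope classical_set_scope.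
Local Open Scope ring_scope.

(** The Euclidean ball lies in the cube, so [A + eps B] is reached from [A] by
    thickening along one coordinate axis at a time. On a line parallel to the
    i-th axis such a step adds a set of length at most [2 eps], and there the
    density is largest on the hyperplane [x_i = 0] since it is even and
    log-concave along the line; hence the step adds mass at most [2 eps F_i(0)],
    with [F_i] the i-th marginal density. By Prekopa-Leindler [F_i] is
    log-concave, and an even log-concave density of variance 1 is at most
    [1 / sqrt 2] at 0, by comparison with the two-sided exponential.

    To stay within Borel sets, a convex set with nonempty interior is replaced by
    its interior; one with empty interior lies in a hyperplane, and its
    enlargement is inside a slab whose sections along a well-chosen axis have
    length at most [2 n eps]. *)

(** * Iterated integrals *)

(** Mass is an iterated lower integral: it is monotone for arbitrary sets, but additivity, Tonelli
    and monotone convergence need Borel integrands. Since convex sets need not be Borel, the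
    difference set is first put inside a Borel one, at the price of a radius [r > eps] that tends to
    [eps] at the end.

    Prekopa-Leindler is proved only for functions decreasing in every [|x_j|]. Their layers on a
    line are intervals symmetric about 0, for which Brunn-Minkowski is a comparison of suprema, and
    the class is stable under integrating out coordinates, which drives the induction on the
    dimension.

    The variance comparison is kept in the homogeneous form [2 F(0)^2 M_2 <= M_0^3], with [M_0] the
    mass and [M_2] the second moment. It therefore applies to truncated densities without
    renormalization, and isotropy enters only when the truncation is removed.

    The constant is [n] steps of [2 eps / sqrt 2] each, that is [sqrt 2 n eps]; the degenerate case
    gives the same number, as one step with sections of length [2 n eps]. *)

Section iterated_integral.
Set Implicit Arguments.
Unset Strict Implicit.
Context {R : realType}.
Notation mu := (@lebesgue_measure R).
Implicit Types (g h : seq R -> \bar R) (s p : seq R).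
Local Open Scope ereal_scope.

(* Subsumes nonmeasurable integrands, for which [integral] is a lower integral. *)
Lemma le_lower_integral (u v : R -> \bar R) :
  (forall x, 0 <= u x) -> (forall x, u x <= v x) ->
  \int[mu]_x u x <= \int[mu]_x v x.
Proof.
move=> u0 uv; have v0 x : 0 <= v x by exact: le_trans (uv x).
rewrite !ge0_integralTE//; apply: ereal_sup_le => _ [h hu <-].
by exists h => // x; exact: le_trans (uv x).
Qed.

(* Borel measurability on R^k, phrased through measurable parametrizations to
   avoid putting a measurable structure on sequences. *)
Definition borel_seq k g := forall d (X : measurableType d) (phi : X -> seq R),
  (forall x, size (phi x) = k) ->
  (forall i, measurable_fun setT (fun x => nth 0%R (phi x) i)) ->
  measurable_fun setT (fun x => g (phi x)).

Lemma iint_ge0 k g : (forall s, 0 <= g s) -> 0 <= iint k g.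
Proof.
elim: k g => [|k IH] g g0 /=; first exact: g0.
by apply: integral_ge0 => x _; apply: IH.
Qed.

Lemma le_iint k g h : (forall s, 0 <= g s) ->
  (forall s, size s = k -> g s <= h s) -> iint k g <= iint k h.
Proof.
elim: k g h => [|k IH] g h g0 gh /=; first exact: gh.
apply: le_lower_integral => x; first exact: iint_ge0.
by apply: IH => // s sk; apply: gh; rewrite /= sk.
Qed.

Lemma eq_iint k g h : (forall s, size s = k -> g s = h s) -> iint k g = iint k h.
Proof.
elim: k g h => [|k IH] g h gh /=; first exact: gh.
by apply: eq_integral => x _; apply: IH => s sk; apply: gh; rewrite /= sk.
Qed.

Lemma measurable_nth_cat d (X : measurableType d) (u v : X -> seq R) m :
  (forall x, size (u x) = m) ->
  (forall i, measurable_fun setT (fun x => nth 0%R (u x) i)) ->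
  (forall i, measurable_fun setT (fun x => nth 0%R (v x) i)) ->
  forall i, measurable_fun setT (fun x => nth 0%R (u x ++ v x) i).
Proof.
move=> um mu_ mv i; have [im|mi] := ltnP i m.
  by under eq_fun do rewrite nth_cat um im; exact: mu_.
by under eq_fun do rewrite nth_cat um ltnNge mi /=; exact: mv.
Qed.

Lemma measurable_nth_cons d (X : measurableType d) (t : X -> R) (v : X -> seq R) :
  measurable_fun setT t ->
  (forall i, measurable_fun setT (fun x => nth 0%R (v x) i)) ->
  forall i, measurable_fun setT (fun x => nth 0%R (t x :: v x) i).
Proof. by move=> mt mv [|i] //=; exact: mv. Qed.

Lemma measurable_nth_cst d (X : measurableType d) s i :
  measurable_fun setT (fun x : X => nth 0%R s i).
Proof. exact: measurable_cst. Qed.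

Lemma borel_seq_cat j k g p : size p = j -> borel_seq (j + k) g ->
  borel_seq k (fun s => g (p ++ s)).
Proof.
move=> pj bg d X phi phik mphi; apply: bg => [x|].
  by rewrite size_cat pj phik.
by apply: measurable_nth_cat => // i; exact: measurable_nth_cst.
Qed.

Lemma borel_seq_cons k g x : borel_seq k.+1 g -> borel_seq k (fun s => g (x :: s)).
Proof. exact: (@borel_seq_cat 1 k g [:: x]). Qed.

(** The parameters form a prefix [p] so that an integration variable can join them: the integral
    over the other variables is Borel in [rcons p t] by induction, and Tonelli's measurability
    statement then integrates [t] out. *)
Lemma borel_seq_iint j k g : (forall s, 0 <= g s) -> borel_seq (j + k) g ->
  borel_seq j (fun p => iint k (fun s => g (p ++ s))).
Proof.
elim: k j g => [|k IH] j g g0 bg /=.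
  by rewrite addn0 in bg; under eq_fun do rewrite cats0.
move=> d X phi phij mphi.
pose G p := iint k (fun s => g (p ++ s)).
have bG : borel_seq j.+1 G by apply: IH => //; rewrite addSnnS.
rewrite (_ : (fun x => _) = (fun x => \int[mu]_t G (rcons (phi x) t))); last first.
  by apply/funext => x; apply: eq_integral => t _; rewrite /G; apply: eq_iint => s _;
     rewrite cat_rcons.
apply: (@measurable_fun_fubini_tonelli_F _ _ X _ R mu
   (fun z => G (rcons (phi z.1) z.2))) => /=; last first.
  by move=> z; apply: iint_ge0.
apply: bG => [z|]; first by rewrite size_rcons phij.
move=> i; under eq_fun do rewrite -cats1.
apply: (@measurable_nth_cat _ _ (fun z : X * R => phi z.1) (fun z => [:: z.2]) j).
- by move=> z; exact: phij.
- by move=> l; exact: (measurableT_comp (mphi l) measurable_fst).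
- exact: (@measurable_nth_cons _ _ snd (fun=> [::])).
Qed.

Lemma measurable_iint_cons k g : (forall s, 0 <= g s) -> borel_seq k.+1 g ->
  measurable_fun setT (fun x => iint k (fun s => g (x :: s))).
Proof.
move=> g0 bg.
apply: (@borel_seq_iint 1 k g g0 bg _ R (fun x => [:: x])) => //.
exact: (@measurable_nth_cons _ _ id (fun=> [::])).
Qed.

Lemma measurable_iint_pair k (H : R -> R -> seq R -> \bar R) :
  (forall x t s, 0 <= H x t s) ->
  borel_seq k.+2 (fun q => H (nth 0%R q 0) (nth 0%R q 1) (drop 2 q)) ->
  measurable_fun setT (fun z : R * R => iint k (H z.1 z.2)).
Proof.
move=> H0 bH.
have E z : iint k (H z.1 z.2) = iint k (fun s => H (nth 0%R ([:: z.1; z.2] ++ s) 0)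
    (nth 0%R ([:: z.1; z.2] ++ s) 1) (drop 2 ([:: z.1; z.2] ++ s))).
  by apply: eq_iint => s _; rewrite /= drop0.
under eq_fun do rewrite E.
apply: (@borel_seq_iint 2 k _ (fun q => H0 _ _ _) bH _ (R * R)%type
  (fun z => [:: z.1; z.2])) => //.
by apply: measurable_nth_cons => //; exact: measurable_nth_cons.
Qed.

Definition insert_at i (t : R) s := take i s ++ t :: drop i s.

Lemma size_insert_at i t s : (i <= size s)%N -> size (insert_at i t s) = (size s).+1.
Proof. by move=> ?; rewrite /insert_at size_cat /= addnS -size_cat cat_take_drop. Qed.

Lemma nth_insert_at i t s j : (i <= size s)%N ->
  nth 0%R (insert_at i t s) j =
  if (j < i)%N then nth 0%R s j else if j == i then t else nth 0%R s j.-1.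
Proof.
move=> si; rewrite /insert_at nth_cat size_takel//.
have [ji|ij] := ltnP j i; first by rewrite nth_take.
case: eqVneq => [->|ji]; first by rewrite subnn.
have {}ij : (i < j)%N by rewrite ltn_neqAle eq_sym ji.
case: j ij {ji} => // j ij; rewrite subSn//= nth_drop subnKC//.
Qed.

Lemma borel_seq_insert_at d (X : measurableType d) k i g (t : X -> R) (phi : X -> seq R) :
  (i <= k)%N -> borel_seq k.+1 g -> measurable_fun setT t ->
  (forall x, size (phi x) = k) ->
  (forall j, measurable_fun setT (fun x => nth 0%R (phi x) j)) ->
  measurable_fun setT (fun x => g (insert_at i (t x) (phi x))).
Proof.
move=> ik bg mt phik mphi; apply: bg => [x|j].
  by rewrite size_insert_at phik.
under eq_fun do rewrite nth_insert_at ?phik//.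
by case: (j < i)%N; [exact: mphi|case: (j == i); [|exact: mphi]].
Qed.

Lemma borel_seq_insert k i g t : (i <= k)%N -> borel_seq k.+1 g ->
  borel_seq k (fun s => g (insert_at i t s)).
Proof. by move=> ik bg d X phi phik mphi; apply: (@borel_seq_insert_at _ _ k). Qed.

(** Tonelli, one transposition per step of the induction on [i]: once the chosen coordinate is
    outermost in the inner integral, it is exchanged with the first variable. *)
Lemma iint_insert k i g : (i <= k)%N -> (forall s, 0 <= g s) -> borel_seq k.+1 g ->
  iint k.+1 g = \int[mu]_t iint k (fun s => g (insert_at i t s)).
Proof.
elim: i k g => [|i IH] k g.
  move=> _ _ _; apply: eq_integral => t _; apply: eq_iint => s _.
  by rewrite /insert_at take0 drop0.
case: k => [|k ik g0 bg]; first by rewrite ltn0.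
have -> : iint k.+2 g = \int[mu]_x iint k.+1 (fun s => g (x :: s)) by [].
under eq_integral => x _ do rewrite (IH k _ ik (fun s => g0 (x :: s)) (borel_seq_cons x bg)).
rewrite (@fubini_tonelli _ _ _ _ _ mu mu
  (fun z => iint k (fun s => g (z.1 :: insert_at i z.2 s))))//=; last first.
  by move=> z; apply: iint_ge0.
apply: (@measurable_iint_pair k (fun x t s => g (x :: insert_at i t s))) => //.
move=> d X phi phik mphi.
apply: (@borel_seq_insert_at _ X k.+1 i.+1 g (fun x => nth 0%R (phi x) 1)
  (fun x => nth 0%R (phi x) 0 :: drop 2 (phi x))) => //.
  by move=> x; rewrite /= size_drop phik subSS subn1.
apply: measurable_nth_cons => // j.
by under eq_fun do rewrite nth_drop; exact: mphi.
Qed.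

(** The first variable travels inwards: insertion at position 1 exchanges it with the second one,
    and the induction hypothesis carries it past the rest. *)
Lemma iint_swap k g : (forall s, 0 <= g s) -> borel_seq k.+1 g ->
  iint k.+1 g = iint k (fun s => \int[mu]_t g (t :: s)).
Proof.
elim: k g => [//|k IH] g g0 bg.
have -> : iint k.+2 g = \int[mu]_t \int[mu]_x iint k (fun s => g (x :: t :: s)).
  rewrite (iint_insert (ltn0Sn k) g0 bg); apply: eq_integral => t _.
  apply: eq_integral => x _; apply: eq_iint => s _.
  by rewrite /insert_at /= take0 drop0.
apply: eq_integral => x _.
have -> : \int[mu]_t iint k (fun s => g (t :: x :: s)) =
  iint k.+1 (fun s => g (head 0%R s :: x :: behead s)) by [].
rewrite IH//.
move=> d X phi phik mphi; apply: bg => [z|].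
  by rewrite /= size_behead phik.
apply: measurable_nth_cons => [|].
  by under eq_fun do rewrite -nth0; exact: mphi.
apply: measurable_nth_cons => // j.
by under eq_fun do rewrite nth_behead; exact: mphi.
Qed.

(** With coordinate [i] innermost, a bound on each line parallel to that axis can be used pointwise
    in the other coordinates. *)
Lemma iint_insert_in k i g : (i <= k)%N -> (forall s, 0 <= g s) -> borel_seq k.+1 g ->
  iint k.+1 g = iint k (fun s => \int[mu]_t g (insert_at i t s)).
Proof.
move=> ik g0 bg; rewrite (@iint_insert k i)//.
transitivity (iint k.+1 (fun q => g (insert_at i (head 0%R q) (behead q)))) => //.
rewrite iint_swap// => d X phi phik mphi.
apply: (@borel_seq_insert_at _ X k) => //.
- by under eq_fun do rewrite -nth0; exact: mphi.
- by move=> x; rewrite size_behead phik.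
- by move=> j; under eq_fun do rewrite nth_behead; exact: mphi.
Qed.

Lemma iintD k g h : (forall s, 0 <= g s) -> (forall s, 0 <= h s) ->
  borel_seq k g -> borel_seq k h ->
  iint k (fun s => g s + h s) = iint k g + iint k h.
Proof.
elim: k g h => [//|k IH] g h g0 h0 bg bh /=.
under eq_integral => x _ do rewrite (IH _ _ (fun s => g0 (x :: s)) (fun s => h0 (x :: s))
  (borel_seq_cons x bg) (borel_seq_cons x bh)).
rewrite ge0_integralD//.
- by move=> x _; apply: iint_ge0.
- exact: measurable_iint_cons.
- by move=> x _; apply: iint_ge0.
- exact: measurable_iint_cons.
Qed.

Lemma iintZl k g (c : R) : (0 <= c)%R -> (forall s, 0 <= g s) -> borel_seq k g ->
  iint k (fun s => c%:E * g s) = c%:E * iint k g.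
Proof.
move=> c0; elim: k g => [//|k IH] g g0 bg /=.
under eq_integral => x _ do rewrite (IH _ (fun s => g0 (x :: s)) (borel_seq_cons x bg)).
rewrite ge0_integralZl_EFin//; first by move=> x _; apply: iint_ge0.
exact: measurable_iint_cons.
Qed.

Lemma cvg_iint k (G : nat -> seq R -> \bar R) g :
  (forall N s, 0 <= G N s) -> (forall N, borel_seq k (G N)) ->
  (forall s, nondecreasing_seq (G ^~ s)) ->
  (forall s, G N s @[N --> \oo] --> g s) ->
  iint k (G N) @[N --> \oo] --> iint k g.
Proof.
elim: k G g => [|k IH] G g G0 bG ndG Gg /=; first exact: Gg.
pose F N x := iint k (fun s => G N (x :: s)).
have ndF x : nondecreasing_seq (F ^~ x).
  by move=> a b ab; apply: le_iint => // s _; exact: ndG.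
have FF x : F N x @[N --> \oo] --> iint k (fun s => g (x :: s)).
  by apply: IH => // N; exact: borel_seq_cons.
rewrite (_ : \int[mu]_x iint k _ = \int[mu]_x limn (F ^~ x)); last first.
  by apply: eq_integral => x _; apply/esym/cvg_lim => //; exact: FF.
apply: cvg_monotone_convergence => //.
- by move=> N; exact: measurable_iint_cons.
- by move=> N x _; apply: iint_ge0.
- by move=> x _; exact: ndF.
Qed.

End iterated_integral.

(** * The Prekopa-Leindler inequality *)

Section one_dimensional.
Context {R : realType}.
Set Implicit Arguments.
Unset Strict Implicit.
Notation mu := (@lebesgue_measure R).
Implicit Types (S : set R) (f g h : R -> R).

Definition symmetric_decreasing f := forall x y, `|y| <= `|x| -> f x <= f y.

(** These are the intervals symmetric about 0, including the empty set and the whole line. *)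
Definition symmetric_starlike S := forall x y, S x -> `|y| <= `|x| -> S y.

Lemma symmetric_starlike_measurable S : symmetric_starlike S -> measurable S.
Proof.
move=> sS; apply: is_interval_measurable => x y Sx Sy z /andP[xz zy].
have [z0|z0] := leP 0 z; [apply: (sS y)|apply: (sS x)] => //.
  by rewrite !ger0_norm// (le_trans z0).
by rewrite (ltr0_norm z0) ler0_norm ?lerN2// (le_trans xz)// ltW.
Qed.

Lemma le_sup_symmetric_starlike S N x : symmetric_starlike S ->
  (forall x, S x -> `|x| <= N) -> S x -> `|x| <= sup S.
Proof.
move=> sS bS Sx; apply: ub_le_sup; last by apply: (sS x) => //; rewrite normr_id.
by exists N => y /bS; exact: le_trans (ler_norm y).
Qed.

Lemma lebesgue_measure_symmetric_itv (r : R) :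
  0 <= r -> mu [set x | `|x| <= r] = (2 * r)%:E /\ mu [set x | `|x| < r] = (2 * r)%:E.
Proof.
move=> r0; split.
  rewrite (_ : [set x | _] = `[-r, r]%classic); last first.
    by apply/seteqP; split=> x /=; rewrite in_itv/= ler_norml.
  rewrite lebesgue_measure_itv/= lte_fin; case: ltP => [_|rr].
    by rewrite -EFinB; congr EFin; ring.
  by have r00 : r = 0; [lra|rewrite r00 mulr0].
rewrite (_ : [set x | _] = `]-r, r[%classic); last first.
  by apply/seteqP; split=> x /=; rewrite in_itv/= ltr_norml.
rewrite lebesgue_measure_itv/= lte_fin; case: ltP => [_|rr].
  by rewrite -EFinB; congr EFin; ring.
by have r00 : r = 0; [lra|rewrite r00 mulr0].
Qed.

(** A bounded nonempty symmetric interval has length twice its supremum, and suprema combine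
    linearly. [S1] and [S2] are bounded above by closed intervals and [S3] below by an open one, so
    endpoints need no discussion. *)
Lemma brunn_minkowski_symmetric S1 S2 S3 N (l : R) : 0 < l < 1 ->
  symmetric_starlike S1 -> symmetric_starlike S2 -> symmetric_starlike S3 ->
  (forall x, S1 x -> `|x| <= N) -> (forall x, S2 x -> `|x| <= N) ->
  S1 0 -> S2 0 ->
  (forall x y, S1 x -> S2 y -> S3 ((1 - l) * x + l * y)) ->
  ((1 - l)%:E * mu S1 + l%:E * mu S2 <= mu S3)%E.
Proof.
move=> /andP[l0 l1] s1 s2 s3 b1 b2 z1 z2 S123.
have ub S : symmetric_starlike S -> (forall x, S x -> `|x| <= N) -> S 0 ->
    0 <= sup S /\ (mu S <= (2 * sup S)%:E)%E.
  move=> sS bS S0; have r0 : 0 <= sup S.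
    by rewrite -(normr0 R); exact: (le_sup_symmetric_starlike sS bS).
  split => //; rewrite -(lebesgue_measure_symmetric_itv r0).1.
  apply: le_measure; rewrite ?inE.
  - exact: symmetric_starlike_measurable.
  - by apply: symmetric_starlike_measurable => x y /=; move=> /[swap]; exact: le_trans.
  - by move=> x; exact: (le_sup_symmetric_starlike sS bS).
have [r10 m1] := ub _ s1 b1 z1; have [r20 m2] := ub _ s2 b2 z2.
set r := (1 - l) * sup S1 + l * sup S2.
have r0 : 0 <= r by apply: addr_ge0; apply: mulr_ge0 => //; lra.
apply: (@le_trans _ _ (2 * r)%:E).
  rewrite (_ : 2 * r = (1 - l) * (2 * sup S1) + l * (2 * sup S2)); last first.
    by rewrite /r; ring.
  rewrite [leRHS]EFinD (EFinM (1 - l)) (EFinM l).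
  by apply: leeD; apply: lee_wpmul2l => //; rewrite lee_fin; lra.
rewrite -(lebesgue_measure_symmetric_itv r0).2.
apply: le_measure; rewrite ?inE.
- by apply: symmetric_starlike_measurable => x y /=; move=> /[swap]; exact: le_lt_trans.
- exact: symmetric_starlike_measurable.
(* The gap [e] is the tolerance for both suprema: points of [S1] and [S2] within [e] of them combine
   to a point beyond [r - e = |z|]. *)
move=> z /= zr; set e := r - `|z|.
have e0 : 0 < e by rewrite subr_gt0.
have hs S : (forall x, S x -> `|x| <= N) -> S 0 -> has_sup S.
  move=> bS S0; split; first by exists 0.
  by exists N => y /bS; exact: le_trans (ler_norm y).
have [x S1x xr] := sup_adherent e0 (hs _ b1 z1).
have [y S2y yr] := sup_adherent e0 (hs _ b2 z2).
apply: (s3 _ _ (S123 _ _ S1x S2y)); apply: le_trans (ler_norm _).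
have -> : `|z| = r - e by rewrite /e; ring.
rewrite /r; nra.
Qed.

Lemma layer_cake_aux f : measurable_fun setT f ->
  measurable [set z : R * R | 0 < z.2 < f z.1].
Proof.
move=> mf.
rewrite (_ : [set z | _] = (fun z : R * R => (0 < z.2) && (z.2 < f z.1)) @^-1` [set true]).
  rewrite -[X in measurable X]setTI.
  apply: measurable_and => //; apply: measurable_fun_ltr => //.
  exact: measurableT_comp.
by [].
Qed.

(** Both sides are the area under the graph. The condition [0 < a] empties the layers at [a <= 0],
    so [a] can range over the whole line. *)
Lemma layer_cake f : measurable_fun setT f -> (forall x, 0 <= f x) ->
  (\int[mu]_x (f x)%:E = \int[mu]_a mu [set x | 0 < a < f x]%R)%E.
Proof.
move=> mf f0; have mA := layer_cake_aux mf.
transitivity (\int[mu]_x \int[mu]_a (\1_[set z : R * R | 0 < z.2 < f z.1]%R (x, a))%:E)%E.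
  apply: eq_integral => x _.
  rewrite (_ : (fun a => _) = (fun a => (\1_(`]0, f x[%classic : set R) a)%:E)); last first.
    by apply/funext => a; rewrite !indicE; congr ((_ : bool)%:R%:E); apply/idP/idP; rewrite !inE//= in_itv.
  rewrite integral_indic//= setIT lebesgue_measure_itv/= lte_fin.
  by case: ltP => [_|]; [rewrite sube0|move=> ?; congr EFin; apply/eqP; rewrite eq_le f0 andbT].
rewrite (@fubini_tonelli _ _ _ _ _ mu mu
  (fun z => (\1_[set z : R * R | 0 < z.2 < f z.1]%R z)%:E))/=; last 2 first.
- by apply/measurable_EFinP; exact: measurable_indic.
- by move=> z; rewrite lee_fin.
apply: eq_integral => a _.
rewrite (_ : (fun x => _) = (fun x => (\1_[set x | 0 < a < f x] x)%:E)); last first.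
  by apply/funext => x; rewrite !indicE; congr ((_ : bool)%:R%:E); apply/idP/idP; rewrite !inE.
rewrite integral_indic ?setIT//.
have := measurable_ysection a mA; congr measurable.
by rewrite /ysection; apply/seteqP; split => x /=; rewrite inE.
Qed.

Lemma measurable_layer f : measurable_fun setT f ->
  measurable_fun setT (fun a : R => mu [set x | 0 < a < f x]).
Proof.
move=> mf; have mA := layer_cake_aux mf.
have := measurable_fun_ysection mu mA; congr measurable_fun.
apply/funext => a /=; congr (mu _).
by rewrite /ysection; apply/seteqP; split => x /=; rewrite inE.
Qed.

End one_dimensional.

Section prekopa_leindler_1d.
Context {R : realType}.
Set Implicit Arguments.
Unset Strict Implicit.
Notation mu := (@lebesgue_measure R).
Implicit Types (f g h : R -> R).

(** Young's inequality for [a^(1-l)] and [b^l] with the conjugate exponents [1/(1-l)] and [1/l]. *)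
Lemma powR_amgm (a b l : R) : 0 < l < 1 -> 0 <= a -> 0 <= b ->
  a `^ (1 - l) * b `^ l <= (1 - l) * a + l * b.
Proof.
move=> /andP[l0 l1] a0 b0.
have m0 : 0 < 1 - l by lra.
have := @conjugate_powR R (a `^ (1 - l)) (b `^ l) (1 - l)^-1 l^-1
  (powR_ge0 _ _) (powR_ge0 _ _).
rewrite !invr_gt0 !invrK => /(_ m0 l0 (subrK _ _)).
rewrite -!powRrM !mulfV ?gt_eqF// !powRr1//.
by rewrite (mulrC a) (mulrC b).
Qed.

Lemma symmetric_decreasing_layer f a : symmetric_decreasing f ->
  symmetric_starlike [set x | 0 < a < f x].
Proof.
move=> sf x y /= /andP[-> afx] yx /=; exact: lt_le_trans (sf _ _ yx).
Qed.

Lemma le_integral_bounded_support f (N B : R) : 0 <= N -> 0 <= B ->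
  measurable_fun setT f -> (forall x, 0 <= f x <= B) ->
  (forall x, N < `|x| -> f x = 0) ->
  (\int[mu]_x (f x)%:E <= (B * (2 * N))%:E)%E.
Proof.
move=> N0 B0 mf fB fN.
have mN : measurable [set x : R | `|x| <= N].
  by apply: symmetric_starlike_measurable => x y /=; move=> /[swap]; exact: le_trans.
apply: (@le_trans _ _ (\int[mu]_x (B%:E * (\1_[set x : R | `|x| <= N] x)%:E))%E).
  apply: le_lower_integral => x; first by rewrite lee_fin; case/andP: (fB x).
  rewrite -EFinM lee_fin indicE; case: (leP `|x| N) => xN.
    by rewrite mem_set// mulr1; case/andP: (fB x).
  by rewrite fN// mulr_ge0.
rewrite ge0_integralZl_EFin//; last first.
  by apply/measurable_EFinP; exact: measurable_indic.
rewrite integral_indic// setIT [X in (_ * X <= _)%E](_ : _ = (2 * N)%:E) ?EFinM//.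
exact: (lebesgue_measure_symmetric_itv N0).1.
Qed.

(** With equal maxima 1, the layers of [f] and [g] at any height in []0, 1[] both contain 0, so
    Brunn-Minkowski applies height by height. They combine into the layer of [h] because
    [a = a^(1-l) * a^l]. The outcome is the stronger bound by an arithmetic mean. *)
Lemma prekopa_leindler_normalized f g h (N l : R) : 0 < l < 1 ->
  symmetric_decreasing f -> symmetric_decreasing g -> symmetric_decreasing h ->
  measurable_fun setT f -> measurable_fun setT g -> measurable_fun setT h ->
  (forall x, 0 <= f x) -> (forall x, 0 <= g x) -> (forall x, 0 <= h x) ->
  (forall x, N < `|x| -> f x = 0) -> (forall x, N < `|x| -> g x = 0) ->
  f 0 = 1 -> g 0 = 1 ->
  (forall x y, f x `^ (1 - l) * g y `^ l <= h ((1 - l) * x + l * y)) ->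
  ((1 - l)%:E * \int[mu]_x (f x)%:E + l%:E * \int[mu]_x (g x)%:E
    <= \int[mu]_x (h x)%:E)%E.
Proof.
move=> l01 sf sg sh mf mg mh f0 g0 h0 fN gN f1 g1 fgh.
have /andP[l0 l1] := l01; have m0 : 0 < 1 - l by lra.
rewrite !layer_cake//.
have mc (c : R) f' : measurable_fun setT f' ->
    measurable_fun setT (fun a : R => (c%:E * mu [set x | (0 < a < f' x)%R])%E).
  by move=> ?; apply: measurable_funeM; exact: measurable_layer.
rewrite -!ge0_integralZl_EFin//; [|exact: measurable_layer|exact: ltW
  |exact: measurable_layer|exact: ltW].
rewrite -ge0_integralD//; last 4 first.
- by move=> a _; rewrite mule_ge0// lee_fin ltW.
- exact: mc.
- by move=> a _; rewrite mule_ge0// lee_fin ltW.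
- exact: mc.
apply: le_lower_integral => a.
  by rewrite adde_ge0// mule_ge0// lee_fin ltW.
have supp f' x : (forall x, N < `|x| -> f' x = 0) -> 0 < a < f' x -> `|x| <= N.
  move=> f'N /andP[a0 af]; rewrite leNgt; apply/negP => /f'N f'x.
  by move: af; rewrite f'x ltNge (ltW a0).
have [a01|Na01] := boolP (0 < a < 1).
  have /andP[a0 a1] := a01.
  apply: (@brunn_minkowski_symmetric _ _ _ _ N) => //; try exact: symmetric_decreasing_layer.
  - by move=> x /=; exact: supp.
  - by move=> x /=; exact: supp.
  - by rewrite /= f1.
  - by rewrite /= g1.
  move=> x y /= /andP[_ af] /andP[_ ag]; rewrite a0/=; apply: lt_le_trans (fgh x y).
  have {1}-> : a = a `^ (1 - l) * a `^ l.
    by rewrite -powRD ?subrK ?powRr1 ?(ltW a0)// gt_eqF.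
  by apply: ltr_pM; rewrite ?powR_ge0//; apply: gt0_ltr_powR;
    rewrite ?nnegrE ?(ltW a0)// (le_trans (ltW a0))// ltW.
(* At the remaining heights the layers of [f] and [g] are empty, since both functions are at most
   their value 1 at 0. *)
have empty f' : symmetric_decreasing f' -> f' 0 = 1 -> mu [set x | 0 < a < f' x] = 0%E.
  move=> sf' f'1; rewrite (_ : [set x | _] = set0) ?measure0//.
  apply/seteqP; split=> x //= /andP[a0 af]; move: Na01; rewrite a0/= => /negP; apply.
  by apply: (lt_le_trans af); rewrite -f'1; apply: sf'; rewrite normr0.
by rewrite (empty f)// (empty g)// !mule0 adde0.
Qed.

(** Rescaling by the values at 0 reduces to the normalized case, and the arithmetic-geometric
    inequality turns its conclusion into a product. The common bounded support keeps the integrals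
    finite, so that [fine] loses nothing. *)
Lemma prekopa_leindler_1d f g h (N l : R) : 0 < l < 1 -> 0 <= N ->
  symmetric_decreasing f -> symmetric_decreasing g -> symmetric_decreasing h ->
  measurable_fun setT f -> measurable_fun setT g -> measurable_fun setT h ->
  (forall x, 0 <= f x) -> (forall x, 0 <= g x) -> (forall x, 0 <= h x) ->
  (forall x, N < `|x| -> f x = 0) -> (forall x, N < `|x| -> g x = 0) ->
  (forall x, N < `|x| -> h x = 0) ->
  (forall x y, f x `^ (1 - l) * g y `^ l <= h ((1 - l) * x + l * y)) ->
  fine (\int[mu]_x (f x)%:E) `^ (1 - l) * fine (\int[mu]_x (g x)%:E) `^ l
    <= fine (\int[mu]_x (h x)%:E).
Proof.
move=> l01 N0 sf sg sh mf mg mh f0 g0 h0 fN gN hN fgh.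
have /andP[l0 l1] := l01; have m0 : 0 < 1 - l by lra.
have i0 f' : (forall x, 0 <= f' x) -> (0 <= \int[mu]_x (f' x)%:E)%E.
  by move=> f'0; apply: integral_ge0 => x _; rewrite lee_fin.
have vanish f' : symmetric_decreasing f' -> (forall x, 0 <= f' x) -> f' 0 <= 0 ->
    fine (\int[mu]_x (f' x)%:E) = 0.
  move=> sf' f'0 f'00; rewrite integral0_eq// => x _; congr EFin; apply/eqP.
  by rewrite eq_le f'0 andbT (le_trans _ f'00)//; apply: sf'; rewrite normr0.
have [f00|f00] := leP (f 0) 0.
  by rewrite (vanish f)// powR0 ?gt_eqF// mul0r fine_ge0 ?i0.
have [g00|g00] := leP (g 0) 0.
  by rewrite (vanish g)// powR0 ?gt_eqF// mulr0 fine_ge0 ?i0.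
(* The factor for [h] that preserves the hypothesis when [f] and [g] are divided by their values at
   0. *)
set c := f 0 `^ (1 - l) * g 0 `^ l.
have c0 : 0 < c by rewrite mulr_gt0// powR_gt0.
have sZ f' (k : R) : 0 < k -> symmetric_decreasing f' -> symmetric_decreasing (fun x => k * f' x).
  by move=> k0 sf' x y xy; rewrite ler_pM2l// sf'.
have fin f' : symmetric_decreasing f' -> measurable_fun setT f' -> (forall x, 0 <= f' x) ->
    (forall x, N < `|x| -> f' x = 0) -> (\int[mu]_x (f' x)%:E)%E \is a fin_num.
  move=> sf' mf' f'0 f'N; rewrite ge0_fin_numE ?i0//.
  apply: (@le_lt_trans _ _ (f' 0 * (2 * N))%:E); last exact: ltry.
  apply: le_integral_bounded_support => // x.
  by rewrite f'0 sf'// normr0.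
have iZ f' (k : R) : measurable_fun setT f' -> (forall x, 0 <= f' x) -> 0 < k ->
    (\int[mu]_x (k * f' x)%:E = k%:E * \int[mu]_x (f' x)%:E)%E.
  move=> mf' f'0 k0; under eq_integral do rewrite EFinM.
  rewrite ge0_integralZl_EFin ?(ltW k0)//; last exact/measurable_EFinP.
  by move=> x _; rewrite lee_fin.
have key := @prekopa_leindler_normalized (fun x => (f 0)^-1 * f x)
  (fun x => (g 0)^-1 * g x) (fun x => c^-1 * h x) N l l01.
have {key} : ((1 - l)%:E * \int[mu]_x ((f 0)^-1 * f x)%:E
    + l%:E * \int[mu]_x ((g 0)^-1 * g x)%:E <= \int[mu]_x (c^-1 * h x)%:E)%E.
  apply: key => //.
  - by apply: sZ => //; rewrite invr_gt0.
  - by apply: sZ => //; rewrite invr_gt0.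
  - by apply: sZ => //; rewrite invr_gt0.
  - exact: measurable_funM.
  - exact: measurable_funM.
  - exact: measurable_funM.
  - by move=> x; rewrite mulr_ge0// invr_ge0 ltW.
  - by move=> x; rewrite mulr_ge0// invr_ge0 ltW.
  - by move=> x; rewrite mulr_ge0// invr_ge0 ltW.
  - by move=> x /fN ->; rewrite mulr0.
  - by move=> x /gN ->; rewrite mulr0.
  - by rewrite mulVf// gt_eqF.
  - by rewrite mulVf// gt_eqF.
  move=> x y; rewrite ler_pdivlMl//.
  rewrite (_ : c * _ = f x `^ (1 - l) * g y `^ l)//.
  rewrite /c mulrACA -!powRM ?mulr_ge0 ?invr_ge0 ?(ltW f00) ?(ltW g00)//.
  by rewrite !mulrA !mulfV ?gt_eqF// !mul1r.
rewrite !iZ ?invr_gt0//.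
have If := fin f sf mf f0 fN; have Ig := fin g sg mg g0 gN; have Ih := fin h sh mh h0 hN.
rewrite -(fineK If) -(fineK Ig) -(fineK Ih) -!EFinM -EFinD lee_fin /=.
set F := fine _; set G := fine _; set H := fine _ => FGH.
have F0 : 0 <= F by rewrite fine_ge0// i0.
have G0 : 0 <= G by rewrite fine_ge0// i0.
have {1}-> : F = f 0 * ((f 0)^-1 * F) by rewrite mulrA mulfV ?mul1r// gt_eqF.
have {1}-> : G = g 0 * ((g 0)^-1 * G) by rewrite mulrA mulfV ?mul1r// gt_eqF.
have F0' : 0 <= (f 0)^-1 * F by rewrite mulr_ge0// invr_ge0 ltW.
have G0' : 0 <= (g 0)^-1 * G by rewrite mulr_ge0// invr_ge0 ltW.
rewrite (powRM _ (ltW f00) F0') (powRM _ (ltW g00) G0') mulrACA -/c -ler_pdivlMl//.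
exact: le_trans (powR_amgm l01 F0' G0') FGH.
Qed.

End prekopa_leindler_1d.

(** * Second moment of an even log-concave function *)

Section two_sided_exponential.
Context {R : realType}.
Set Implicit Arguments.
Unset Strict Implicit.
Notation mu := (@lebesgue_measure R).

Lemma is_derive_quadratic_exp (a b c k x : R) :
  is_derive x 1 (fun t : R => - ((a * t ^+ 2 + b * t + c) * expR (- (k * t))))
    ((k * (a * x ^+ 2 + b * x + c) - (2 * a * x + b)) * expR (- (k * x))).
Proof.
rewrite (_ : (fun _ => _) =
  - ((a \*: ((@id R) ^+ 2) + b \*: (@id R) + cst c) * (expR \o ((- k) \*: (@id R))))); last first.
  by apply/funext => t; rewrite !fctE /= /GRing.scale /= mulNr.
apply: is_derive_eq.
rewrite !fctE (_ : expR _ = expR (- (k * x))); last by congr expR; exact: mulNr.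
set e := expR _; rewrite /GRing.scale /= /GRing.scale /=; ring.
Qed.

Lemma continuous_quadratic_exp (a b c k : R) :
  continuous (fun t : R => - ((a * t ^+ 2 + b * t + c) * expR (- (k * t)))).
Proof.
move=> x; have dF := is_derive_quadratic_exp a b c k x.
by apply/differentiable_continuous/derivable1_diffP; exact: ex_derive.
Qed.

(** The cubic Taylor term, [exp(kt) >= (kt)^3 / 3!], beats the quadratic factor, which is at most
    [(a + b + c) t^2] for [t >= 1]; what remains is [C / t]. *)
Lemma cvg_quadratic_exp (a b c k : R) : 0 <= a -> 0 <= b -> 0 <= c -> 0 < k ->
  - ((a * t ^+ 2 + b * t + c) * expR (- (k * t))) @[t --> +oo] --> 0.
Proof.
move=> a0 b0 c0 k0.
rewrite -oppr0; apply: cvgN.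
pose C := (a + b + c) * (6 / k ^+ 3).
have k3 : 0 < k ^+ 3 by rewrite exprn_gt0.
apply: (@squeeze_cvgr _ _ _ _ (cst 0) (fun t => C * t^-1)).
- near=> t.
  have t1 : 1 <= t by near: t; exact: nbhs_pinfty_ge.
  have t0 : 0 < t by rewrite (lt_le_trans _ t1).
  apply/andP; split.
    by rewrite mulr_ge0 ?expR_ge0// !addr_ge0 ?mulr_ge0 ?exprn_ge0 ?(ltW t0).
  have e3 : (k * t) ^+ 3 / 6 <= expR (k * t).
    apply: le_trans (expR_ge1Dxn 2 _); last by rewrite mulr_ge0 ?ltW.
    by rewrite lerDr.
  have e3' : 0 < (k * t) ^+ 3 / 6 by rewrite divr_gt0// exprn_gt0// mulr_gt0.
  apply: (@le_trans _ _ ((a + b + c) * t ^+ 2 * ((k * t) ^+ 3 / 6)^-1)).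
    apply: ler_pM; rewrite ?expR_ge0//.
    - by rewrite !addr_ge0 ?mulr_ge0 ?exprn_ge0 ?(ltW t0).
    - have t12 : t <= t ^+ 2 by rewrite expr2 ler_peMl ?ltW.
      have t2 : 1 <= t ^+ 2 by exact: le_trans t12.
      by rewrite 2!mulrDl; apply: lerD; [apply: lerD => //; apply: ler_wpM2l|rewrite ler_peMr].
    - by rewrite expRN lef_pV2 ?posrE ?expR_gt0.
  rewrite /C le_eqVlt; apply/orP; left; apply/eqP.
  by field; rewrite !gt_eqF.
- exact: cvg_cst.
- rewrite -(mulr0 C); apply: cvgM; first exact: cvg_cst.
  apply/gtr0_cvgV0; last exact: cvg_id.
  by exists 0; split.
Unshelve. all: by end_near. Qed.

(** The integrand is the derivative of [-(a t^2 + b t + c) exp(-kt)], which goes from [-c] at 0 to 0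
    at infinity. Parametrizing by the primitive lets one formula yield both the mass and the second
    moment. *)
Lemma integral_quadratic_exp (a b c k : R) : 0 <= a -> 0 <= b -> 0 <= c -> 0 < k ->
  (forall t, 0 <= t -> 0 <= k * (a * t ^+ 2 + b * t + c) - (2 * a * t + b)) ->
  (\int[mu]_(t in `[0%R, +oo[) ((k * (a * t ^+ 2 + b * t + c) - (2 * a * t + b)) * expR (- (k * t)))%:E
    = c%:E)%E.
Proof.
move=> a0 b0 c0 k0 f0.
have dF x := is_derive_quadratic_exp a b c k x.
rewrite (@ge0_continuous_FTC2y _ _
  (fun t : R => - ((a * t ^+ 2 + b * t + c) * expR (- (k * t)))) 0 0).
- by rewrite -EFinB; congr EFin; rewrite (mulr0 k) oppr0 expR0; ring.
- by move=> x x0; rewrite mulr_ge0 ?expR_ge0 ?f0.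
- apply: continuous_subspaceT.
  rewrite (_ : (fun t => _) = (fun t : R => - (((- (k * a)) * t ^+ 2 + (2 * a - k * b) * t
    + (b - k * c)) * expR (- (k * t))))); first exact: continuous_quadratic_exp.
  by apply/funext => t; ring.
- exact: cvg_quadratic_exp.
- by move=> x _; exact: ex_derive.
- by apply: cvg_at_right_filter; exact: continuous_quadratic_exp.
- by move=> x _; rewrite derive1E derive_val.
Qed.

Lemma integral_two_sided_exp (a b c k : R) : 0 <= a -> 0 <= b -> 0 <= c -> 0 < k ->
  (forall t, 0 <= t -> 0 <= k * (a * t ^+ 2 + b * t + c) - (2 * a * t + b)) ->
  (\int[mu]_t ((k * (a * t ^+ 2 + b * `|t| + c) - (2 * a * `|t| + b)) * expR (- (k * `|t|)))%:E
    = (2 * c)%:E)%E.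
Proof.
move=> a0 b0 c0 k0 f0.
pose F (t : R) := (k * (a * t ^+ 2 + b * t + c) - (2 * a * t + b)) * expR (- (k * t)).
have E (t : R) : (k * (a * t ^+ 2 + b * `|t| + c) - (2 * a * `|t| + b)) * expR (- (k * `|t|))
    = F `|t| by rewrite /F real_normK// num_real.
under eq_integral do rewrite E.
rewrite (@ge0_symfun_integralT _ (fun t => F `|t|)).
- rewrite EFinM; congr (_ * _)%E; rewrite -[RHS](integral_quadratic_exp a0 b0 c0 k0 f0).
  rewrite set_itvcy; apply: eq_integral => t; rewrite inE /= => t0.
  by rewrite ger0_norm.
- by move=> x; rewrite mulr_ge0 ?expR_ge0 ?f0.
- move=> x; apply: (@continuous_comp _ _ _ (@Num.norm _ R) F); first exact: norm_continuous.
  have := @continuous_quadratic_exp (- (k * a)) (2 * a - k * b) (b - k * c) k.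
  by move=> /(_ `|x|); rewrite (_ : (fun _ => _) = F)//; apply/funext => t; rewrite /F; ring.
- by move=> x /=; rewrite normrN.
Qed.

Lemma integral_laplace (k : R) : 0 < k ->
  (\int[mu]_t (expR (- (k * `|t|)))%:E = (2 / k)%:E)%E.
Proof.
move=> k0; rewrite -(@integral_two_sided_exp 0 0 k^-1 k)//.
- by apply: eq_integral => t _; congr EFin; field; rewrite gt_eqF.
- by rewrite invr_ge0 ltW.
- by move=> t _; rewrite !mul0r !add0r mulr0 mul0r addr0 subr0 mulfV// gt_eqF.
Qed.

Lemma integral_sqr_laplace (k : R) : 0 < k ->
  (\int[mu]_t (t ^+ 2 * expR (- (k * `|t|)))%:E = (4 / k ^+ 3)%:E)%E.
Proof.
move=> k0; have k0' : k != 0 by rewrite gt_eqF.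
have -> : 4 / k ^+ 3 = 2 * (2 / k ^+ 3) by field.
(* The coefficients solve [k a = 1], [k b = 2 a], [k c = b], which collapses the polynomial factor
   to [t^2]. *)
rewrite -(@integral_two_sided_exp k^-1 (2 / k ^+ 2) (2 / k ^+ 3) k)//.
- by apply: eq_integral => t _; congr EFin; congr (_ * _); field.
- by rewrite invr_ge0 ltW.
- by rewrite divr_ge0// exprn_ge0// ltW.
- by rewrite divr_ge0// exprn_ge0// ltW.
- move=> t _; rewrite (_ : _ - _ = t ^+ 2) ?sqr_ge0//; field => //.
Qed.

End two_sided_exponential.

Section variance_bound.
Context {R : realType}.
Set Implicit Arguments.
Unset Strict Implicit.
Notation mu := (@lebesgue_measure R).

(* The two-sided exponential with the same value at 0 and the same mass as
   [phi] lies below [phi] on [-a, a] and above it outside, hence has the larger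
   second moment. *)
Lemma second_moment_le (phi : R -> R) (N : R) : 0 <= N ->
  symmetric_decreasing phi -> measurable_fun setT phi -> (forall x, 0 <= phi x) ->
  (forall x, N < `|x| -> phi x = 0) ->
  (forall t l, 0 < l < 1 -> phi 0 `^ (1 - l) * phi t `^ l <= phi (l * t)) ->
  2 * phi 0 ^+ 2 * fine (\int[mu]_t (t ^+ 2 * phi t)%:E)
    <= fine (\int[mu]_t (phi t)%:E) ^+ 3.
Proof.
move=> N0 sphi mphi phi0 phiN lc.
have I0 : (0 <= \int[mu]_t (phi t)%:E)%E by apply: integral_ge0 => t _; rewrite lee_fin.
have Ifin : (\int[mu]_t (phi t)%:E)%E \is a fin_num.
  rewrite ge0_fin_numE//; apply: (@le_lt_trans _ _ (phi 0 * (2 * N))%:E); last exact: ltry.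
  by apply: le_integral_bounded_support => // x; rewrite phi0 sphi// normr0.
have J0 : (0 <= \int[mu]_t (t ^+ 2 * phi t)%:E)%E.
  by apply: integral_ge0 => t _; rewrite lee_fin mulr_ge0// sqr_ge0.
have JI : (\int[mu]_t (t ^+ 2 * phi t)%:E <= (N ^+ 2)%:E * \int[mu]_t (phi t)%:E)%E.
  rewrite -ge0_integralZl_EFin ?sqr_ge0//; last 2 first.
  - by move=> x _; rewrite lee_fin.
  - exact/measurable_EFinP.
  apply: le_lower_integral => t; first by rewrite lee_fin mulr_ge0// sqr_ge0.
  rewrite -EFinM lee_fin; have [tN|Nt] := leP `|t| N; last by rewrite phiN// !mulr0.
  by rewrite ler_wpM2r// -(real_normK (num_real t)) ler_sqr ?nnegrE.
have Jfin : (\int[mu]_t (t ^+ 2 * phi t)%:E)%E \is a fin_num.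
  rewrite ge0_fin_numE//; apply: (le_lt_trans JI).
  by rewrite -(fineK Ifin) -EFinM ltry.
move: JI J0 I0.
set EI := (\int[mu]_t (phi t)%:E)%E; set EJ := (\int[mu]_t (t ^+ 2 * phi t)%:E)%E.
rewrite -/EI in Ifin; rewrite -/EJ in Jfin.
rewrite -(fineK Ifin) -(fineK Jfin) -EFinM !lee_fin /=.
set I := fine EI; set J := fine EJ => JI J0 I0.
have [c0|c0] := leP (phi 0) 0.
  have -> : phi 0 = 0 by apply/eqP; rewrite eq_le c0 phi0.
  by rewrite expr0n /= mulr0 mul0r exprn_ge0.
have [I1|I1] := leP I 0.
  have I00 : I = 0 by apply/eqP; rewrite eq_le I1 I0.
  have -> : J = 0 by apply/eqP; rewrite eq_le J0 andbT (le_trans JI)// I00 mulr0.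
  by rewrite mulr0 I00 expr0n.
(* A two-sided exponential of height [c] and rate [k] has mass [2 c / k]; this rate makes the mass
   equal to [I]. *)
set c := phi 0 in c0 *; pose k := 2 * c / I.
have k0 : 0 < k by rewrite divr_gt0// mulr_gt0.
pose psi (t : R) := c * expR (- (k * `|t|)).
have psi0 t : 0 < psi t by rewrite mulr_gt0// expR_gt0.
(* The supremum of [S] is the crossing point: 0 is in [S] because both functions equal [c] there,
   and [S] is bounded because [phi] vanishes beyond [N] while [psi] stays positive. *)
pose S := [set t | 0 <= t /\ psi t <= phi t].
have S0 : S 0 by split => //; rewrite /psi normr0 mulr0 oppr0 expR0 mulr1.
have SN t : S t -> t <= N.
  move=> [t0 pt]; rewrite leNgt; apply/negP => Nt.
  by move: pt; rewrite phiN ?ger0_norm// leNgt psi0.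
have hS : has_sup S by split; [exists 0|exists N].
set a := sup S.
have a0 : 0 <= a by apply: ub_le_sup => //; exact: hS.2.
have phiE t : phi t = phi `|t|.
  by apply/eqP; rewrite eq_le !sphi// normr_id.
have psiE t : psi t = psi `|t| by rewrite /psi normr_id.
(* This says [(t^2 - a^2) (psi t - phi t) >= 0]. Writing it with sums avoids subtracting integrals;
   after integration the [a^2] terms cancel because the masses agree. *)
have cross t : t ^+ 2 * phi t + a ^+ 2 * psi t <= t ^+ 2 * psi t + a ^+ 2 * phi t.
  rewrite phiE psiE -(real_normK (num_real t)); move: (normr_ge0 t).
  move: `|t| => {}t t0; rewrite -subr_ge0.
  rewrite (_ : _ - _ = (t ^+ 2 - a ^+ 2) * (psi t - phi t)); last by ring.
  have [ta|at_|->] := ltgtP t a; last by rewrite subrr mul0r.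
    apply: mulr_le0; first by rewrite subr_le0 ler_sqr ?nnegrE// ltW.
    rewrite subr_le0.
    move: t0; rewrite le_eqVlt => /predU1P[<-|t0]; first exact: S0.2.
    have a_t : 0 < a - t by rewrite subr_gt0.
    (* For [s] in [S] beyond [t], [psi <= phi] holds at 0 and at [s]. It passes to [t] because
       [ln phi] is concave along the segment while [ln psi] is affine on it. *)
    have [s [s0 ps]] := sup_adherent a_t hS.
    rewrite -/a subKr => ts; have s0' : 0 < s by exact: lt_trans ts.
    have l01 : 0 < t / s < 1 by rewrite divr_gt0//= ltr_pdivrMr// mul1r.
    have := lc s _ l01; rewrite divfK ?gt_eqF//; apply: le_trans.
    apply: (@le_trans _ _ (c `^ (1 - t / s) * psi s `^ (t / s))); last first.
      rewrite ler_wpM2l ?powR_ge0//; apply: ge0_ler_powR; rewrite ?nnegrE//.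
      - by rewrite ltW//; case/andP: l01.
      - exact/ltW/psi0.
    rewrite /psi powRM ?expR_ge0 ?(ltW c0)// mulrA -powRD; last first.
      by rewrite subrK oner_eq0.
    rewrite subrK powRr1 ?(ltW c0)// ler_pM2l// -expRM ler_expR.
    rewrite !gtr0_norm// le_eqVlt; apply/orP; left; apply/eqP.
    by field; rewrite gt_eqF.
  apply: mulr_ge0; first by rewrite subr_ge0 ler_sqr ?nnegrE// ltW.
  rewrite subr_ge0 leNgt; apply/negP => pt.
  by move: at_; rewrite ltNge => /negP; apply; apply: ub_le_sup; [exact: hS.2|split => //; exact: ltW].
have mexp : measurable_fun setT (fun t : R => expR (- (k * `|t|))).
  apply: continuous_measurable_fun => t.
  apply: continuous_comp; last exact: continuous_expR.
  by apply: cvgN; apply: cvgM; [exact: cvg_cst|exact: norm_continuous].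
have mpsi : measurable_fun setT psi by exact: measurable_funM.
have mphi2 : measurable_fun setT (fun t : R => t ^+ 2 * phi t) by exact: measurable_funM.
have mpsi2 : measurable_fun setT (fun t : R => t ^+ 2 * psi t) by exact: measurable_funM.
have intD (f g : R -> R) : measurable_fun setT f -> measurable_fun setT g ->
    (forall x, 0 <= f x) -> (forall x, 0 <= g x) ->
    (\int[mu]_t (t ^+ 2 * f t + a ^+ 2 * g t)%:E
      = \int[mu]_t (t ^+ 2 * f t)%:E + (a ^+ 2)%:E * \int[mu]_t (g t)%:E)%E.
  move=> mf mg f0 g0.
  rewrite -ge0_integralZl_EFin ?sqr_ge0//; last 2 first.
  - by move=> x _; rewrite lee_fin.
  - exact/measurable_EFinP.
  rewrite -ge0_integralD//.
  - by move=> x _; rewrite lee_fin mulr_ge0// sqr_ge0.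
  - by apply/measurable_EFinP; exact: measurable_funM.
  - by move=> x _; rewrite -EFinM lee_fin mulr_ge0// sqr_ge0.
  - by apply/measurable_EFinP; exact: measurable_funM.
have psi_int : (\int[mu]_t (psi t)%:E = I%:E)%E.
  under eq_integral do rewrite EFinM.
  rewrite ge0_integralZl_EFin ?(ltW c0)//; last exact/measurable_EFinP.
  rewrite integral_laplace// -EFinM /k; congr EFin; field.
  by rewrite !gt_eqF.
have psi2_int : (\int[mu]_t (t ^+ 2 * psi t)%:E = (I ^+ 3 / (2 * c ^+ 2))%:E)%E.
  under eq_integral do rewrite /psi mulrCA EFinM.
  rewrite ge0_integralZl_EFin ?(ltW c0)//; last 2 first.
  - by move=> x _; rewrite lee_fin mulr_ge0 ?expR_ge0 ?sqr_ge0.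
  - by apply/measurable_EFinP; exact: measurable_funM.
  rewrite integral_sqr_laplace// -EFinM /k; congr EFin; field.
  by rewrite !gt_eqF.
have : (\int[mu]_t (t ^+ 2 * phi t + a ^+ 2 * psi t)%:E
    <= \int[mu]_t (t ^+ 2 * psi t + a ^+ 2 * phi t)%:E)%E.
  apply: le_lower_integral => t; rewrite lee_fin//.
  by rewrite addr_ge0// mulr_ge0 ?sqr_ge0// ltW.
have psige t : 0 <= psi t by exact: ltW.
rewrite !intD// psi_int psi2_int -/EI -/EJ -(fineK Ifin) -(fineK Jfin) -!EFinM -!EFinD lee_fin.
rewrite -/I -/J lerD2r ler_pdivlMr; last by rewrite mulr_gt0// exprn_gt0.
by rewrite mulrC.
Qed.

End variance_bound.

(** * Prekopa-Leindler in dimension [k], and the second moment of a marginal *)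

Section prekopa_leindler.
Context {R : realType}.
Set Implicit Arguments.
Unset Strict Implicit.
Notation mu := (@lebesgue_measure R).
Implicit Types (f g h : seq R -> \bar R) (s : seq R).

Definition tame k (N B : R) g :=
  [/\ borel_seq k g, (forall s, 0 <= g s)%E, (forall s, size s = k -> g s <= B%:E)%E,
      (forall s s', size s = k -> size s' = k ->
        (forall j, `|nth 0 s' j| <= `|nth 0 s j|) -> (g s <= g s')%E) &
      (forall s j, size s = k -> N < `|nth 0 s j| -> g s = 0%E)].

Definition interpolates k f g h (l : R) := forall x y z,
  size x = k -> size y = k -> size z = k ->
  (forall j, nth 0 z j = (1 - l) * nth 0 x j + l * nth 0 y j) ->
  fine (f x) `^ (1 - l) * fine (g y) `^ l <= fine (h z).

Lemma tame_cons k N B g x : tame k.+1 N B g -> tame k N B (fun s => g (x :: s)).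
Proof.
move=> [bg g0 gB gs gN]; split => //.
- exact: borel_seq_cons.
- by move=> s sk; apply: gB; rewrite /= sk.
- move=> s s' sk s'k ss'; apply: gs; rewrite /= ?sk ?s'k//.
  by case.
- by move=> s j sk Ns; apply: (gN _ j.+1) => //=; rewrite sk.
Qed.

Lemma tame_insert k i N B g t : (i <= k)%N ->
  tame k.+1 N B g -> tame k N B (fun s => g (insert_at i t s)).
Proof.
move=> ik [bg g0 gB gs gN]; split => //.
- exact: borel_seq_insert.
- by move=> s sk; apply: gB; rewrite size_insert_at ?sk.
- move=> s s' sk s'k ss'; apply: gs; rewrite ?size_insert_at ?sk ?s'k// => j.
  by rewrite !nth_insert_at ?sk ?s'k//; case: ifP => // _; case: ifP.
(* Entry [j] of [s] becomes entry [bump i j] once [t] occupies position [i]. *)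
- move=> s j sk Ns; apply: (gN _ (bump i j)); first by rewrite size_insert_at sk.
  rewrite nth_insert_at ?sk// /bump; case: (leqP i j) => ij.
    by rewrite ltnNge (leqW ij)/= gtn_eqF.
  by rewrite add0n ij.
Qed.

Lemma iint0 k : iint k (fun=> 0%E) = 0%E :> \bar R.
Proof. by elim: k => [//|k IHk] /=; rewrite integral0_eq. Qed.

Lemma tame_iint_le k N B g : 0 <= N -> 0 <= B -> tame k N B g ->
  (iint k g <= (B * (2 * N) ^+ k)%:E)%E.
Proof.
move=> N0 B0; elim: k g => [|k IH] g tg.
  by case: tg => _ _ gB _ _; rewrite expr0 mulr1; exact: gB.
have [bg g0 gB gs gN] := tg.
have F0 x : (0 <= iint k (fun s => g (x :: s)))%E by exact: iint_ge0.
have FB x : (iint k (fun s => g (x :: s)) <= (B * (2 * N) ^+ k)%:E)%E.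
  exact/IH/tame_cons.
have Ff x : iint k (fun s => g (x :: s)) \is a fin_num.
  by rewrite ge0_fin_numE// (le_lt_trans (FB x))// ltry.
rewrite /=; under eq_integral => x _ do rewrite -(fineK (Ff x)).
rewrite exprSr mulrA.
apply: (@le_integral_bounded_support _ (fun x => fine (iint k (fun s => g (x :: s))))) => //.
- by rewrite mulr_ge0// exprn_ge0// mulr_ge0.
- apply/measurable_EFinP; rewrite (_ : _ \o _ = (fun x => iint k (fun s => g (x :: s)))).
    exact: measurable_iint_cons.
  by apply/funext => x /=; rewrite fineK.
- by move=> x; rewrite fine_ge0//= -lee_fin fineK.
- move=> x Nx; rewrite (_ : iint _ _ = 0%E)//; apply/eqP; rewrite eq_le F0 andbT.
  by rewrite -(iint0 k); apply: le_iint => // s sk; rewrite (gN _ 0)//= sk.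
Qed.

Lemma tame_iint_fin k N B g : 0 <= N -> 0 <= B -> tame k N B g ->
  iint k g \is a fin_num.
Proof.
move=> N0 B0 tg; have [_ g0 _ _ _] := tg.
by rewrite ge0_fin_numE ?iint_ge0// (le_lt_trans (tame_iint_le N0 B0 tg))// ltry.
Qed.

Lemma tame_measurable_fine k N B g : 0 <= N -> 0 <= B -> tame k.+1 N B g ->
  measurable_fun setT (fun x => fine (iint k (fun s => g (x :: s)))).
Proof.
move=> N0 B0 tg; have [bg g0 _ _ _] := tg.
apply/measurable_EFinP; rewrite (_ : _ \o _ = (fun x => iint k (fun s => g (x :: s)))).
  exact: measurable_iint_cons.
apply/funext => x /=; rewrite fineK//; apply: (tame_iint_fin N0 B0).
exact: tame_cons.
Qed.

(** Induction on the dimension: with the first coordinate fixed, the induction hypothesis is exactly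
    the one-dimensional hypothesis for the integrals [F] over the other coordinates, and tameness
    makes these symmetric decreasing. *)
Lemma prekopa_leindler k N B f g h l : 0 < l < 1 -> 0 <= N -> 0 <= B ->
  tame k N B f -> tame k N B g -> tame k N B h -> interpolates k f g h l ->
  fine (iint k f) `^ (1 - l) * fine (iint k g) `^ l <= fine (iint k h).
Proof.
move=> l01 N0 B0; elim: k f g h => [|k IH] f g h tf tg th fgh.
  by apply: fgh => // j; rewrite !nth_nil !mulr0 addr0.
have fin u x : tame k.+1 N B u -> iint k (fun s => u (x :: s)) \is a fin_num.
  by move=> tu; apply: (tame_iint_fin N0 B0); exact: tame_cons.
pose F (u : seq R -> \bar R) x := fine (iint k (fun s => u (x :: s))).
have FE u : tame k.+1 N B u -> iint k.+1 u = (\int[mu]_x (F u x)%:E)%E.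
  by move=> tu /=; apply: eq_integral => x _; rewrite fineK// fin.
have sF u : tame k.+1 N B u -> symmetric_decreasing (F u).
  move=> tu x y yx; have [_ u0 _ us _] := tu.
  apply: fine_le; rewrite ?fin//; apply: le_iint => // s sk.
  by apply: us; rewrite /= ?sk//; case.
have F0 u : tame k.+1 N B u -> forall x, 0 <= F u x.
  by move=> [_ u0 _ _ _] x; rewrite fine_ge0//; exact: iint_ge0.
have FN u : tame k.+1 N B u -> forall x, N < `|x| -> F u x = 0.
  move=> [_ u0 _ _ uN] x Nx; rewrite /F (@eq_iint _ _ _ (fun=> 0%E)) ?iint0//.
  by move=> s sk; apply: (uN _ 0) => //=; rewrite sk.
rewrite !FE//; apply: (@prekopa_leindler_1d _ _ _ _ N) => //;
  try exact: sF; try exact: F0; try exact: FN;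
  try exact: (tame_measurable_fine N0 B0).
move=> x y; apply: IH; try exact: tame_cons.
move=> u v w uk vk wk E; apply: fgh; rewrite /= ?uk ?vk ?wk//.
by case.
Qed.

(** [second_moment_le] for the [i]-th marginal [phi]: tameness makes it symmetric decreasing, and
    Prekopa-Leindler between the sections at 0 and at [t] gives its log-concavity. *)
Lemma section_second_moment_le k i N B g : (i <= k)%N -> 0 <= N -> 0 <= B ->
  tame k.+1 N B g -> (forall l, 0 < l < 1 -> interpolates k.+1 g g g l) ->
  2 * fine (iint k (fun s => g (insert_at i 0 s))) ^+ 2
    * fine (iint k.+1 (fun s => (nth 0%R s i ^+ 2)%:E * g s)%E)
  <= fine (iint k.+1 g) ^+ 3.
Proof.
move=> ik N0 B0 tg lg; have [bg g0 gB gs gN] := tg.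
pose phi t := fine (iint k (fun s => g (insert_at i t s))).
have fin t : iint k (fun s => g (insert_at i t s)) \is a fin_num.
  by apply: (tame_iint_fin N0 B0); exact: tame_insert.
have phiE t : (phi t)%:E = iint k (fun s => g (insert_at i t s)) by rewrite fineK.
have b2 : borel_seq k.+1 (fun s => (nth 0%R s i ^+ 2)%:E * g s)%E.
  move=> d X u uk mu_; apply: emeasurable_funM; last exact: bg.
  by apply/measurable_EFinP; exact: measurable_funX.
have g20 s : (0 <= (nth 0%R s i ^+ 2)%:E * g s)%E.
  by rewrite mule_ge0// lee_fin sqr_ge0.
rewrite (iint_insert ik g0 bg) (iint_insert ik g20 b2).
under [in X in _ <= X]eq_integral do rewrite -phiE.
rewrite (_ : (fun t => iint k _) = (fun t => (t ^+ 2 * phi t)%:E)); last first.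
  apply/funext => t; rewrite EFinM phiE -iintZl ?sqr_ge0//; last exact: borel_seq_insert.
  by apply: eq_iint => s sk; rewrite nth_insert_at ?sk// ltnn eqxx.
rewrite -/(phi 0); apply: (@second_moment_le _ _ N) => //.
- move=> x y yx; apply: fine_le; rewrite ?fin//; apply: le_iint => // s sk.
  apply: gs; rewrite ?size_insert_at ?sk// => j.
  by rewrite !nth_insert_at ?sk//; case: ifP => // _; case: ifP.
- apply/measurable_EFinP; rewrite (_ : _ \o _ = (fun t => iint k (fun s => g (insert_at i t s)))).
    apply: (@measurable_iint_cons _ k (fun q => g (insert_at i (head 0 q) (behead q)))) => //.
    move=> d X u uk mu_; apply: (@borel_seq_insert_at _ _ X k) => //.
    + by under eq_fun do rewrite -nth0; exact: mu_.
    + by move=> x; rewrite size_behead uk.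
    + by move=> j; under eq_fun do rewrite nth_behead; exact: mu_.
  by apply/funext => t; exact: phiE.
- by move=> t; rewrite fine_ge0// iint_ge0.
- move=> t Nt; rewrite /phi (@eq_iint _ _ _ (fun=> 0%E)) ?iint0//.
  move=> s sk; apply: (gN _ i); first by rewrite size_insert_at sk.
  by rewrite nth_insert_at ?sk// ltnn eqxx.
- move=> t l l01; apply: (prekopa_leindler l01 N0 B0); try exact: tame_insert.
  move=> x y z xk yk zk E; apply: lg; rewrite ?size_insert_at ?xk ?yk ?zk// => j.
  rewrite !nth_insert_at ?xk ?yk ?zk//; case: ifP => // _; case: ifP => // _.
  by rewrite mulr0 add0r.
Qed.

End prekopa_leindler.

(** * Unconditional log-concave densities *)

Section density.
Context {R : realType}.
Set Implicit Arguments.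
Unset Strict Implicit.
Notation mu := (@lebesgue_measure R).

Definition row_of n (s : seq R) : 'rV[R]_n := \row_(i < n) nth 0 s i.

(** Companion of [borel_seq] for sets. The length of [phi x] is left free because [row_of] reads [n]
    entries and fills in zeros. *)
Definition borel_set n (U : set 'rV[R]_n) := forall d (X : measurableType d)
  (phi : X -> seq R), (forall i, measurable_fun setT (fun x => nth 0 (phi x) i)) ->
  measurable [set x | U (row_of n (phi x))].

Lemma measurable_forall_ord n d (X : measurableType d) (A : 'I_n -> set X) :
  (forall i, measurable (A i)) -> measurable [set x | forall i, A i x].
Proof.
move=> mA; rewrite (_ : [set x | _] = \bigcap_(i in [set: 'I_n]) A i).
  exact: fin_bigcap_measurable.
by apply/seteqP; split=> [x Ax i _|x Ax i]; [exact: Ax|exact: Ax].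
Qed.

Lemma measurable_sublevel d (X : measurableType d) (u : X -> R) (r : R) :
  measurable_fun setT u ->
  measurable [set x | u x < r] /\ measurable [set x | u x <= r].
Proof.
move=> mu_; split.
  rewrite (_ : [set x | _] = setT `&` u @^-1` `]-oo, r[%classic); first exact: mu_.
  by rewrite setTI; apply/seteqP; split => x /=; rewrite in_itv.
rewrite (_ : [set x | _] = setT `&` u @^-1` `]-oo, r]%classic); first exact: mu_.
by rewrite setTI; apply/seteqP; split => x /=; rewrite in_itv.
Qed.

(** An open set is the countable union of the cubes with rational centre and radius [1/(m+1)] that
    it contains. *)
Lemma open_borel_set n (U : set 'rV[R]_n) : open U -> borel_set U.
Proof.
move=> oU d X phi mphi.
pose box (q : {ffun 'I_n -> rat} * nat) : set 'rV[R]_n :=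
  [set v | forall i, `|ratr (q.1 i) - v ord0 i| < (q.2.+1%:R)^-1].
rewrite (_ : [set x | _] = \bigcup_(q in [set: {ffun 'I_n -> rat} * nat])
    (if `[< box q `<=` U >] then [set x | box q (row_of n (phi x))] else set0)).
  apply: countable_bigcupT_measurable => // q; case: ifP => // _.
  rewrite (_ : [set x | _] = [set x | forall i : 'I_n,
      [set x | `|ratr (q.1 i) - nth 0 (phi x) i| < (q.2.+1%:R)^-1] x]).
    apply: measurable_forall_ord => i.
    apply: (measurable_sublevel _ _).1; apply: measurableT_comp => //.
    exact: measurable_funB.
  by apply/seteqP; split => x /= bx i; have := bx i; rewrite mxE.
apply/seteqP; split => [x /= Ux|x [q _]]; last first.
  by case: asboolP => // qU; exact: qU.
set v := row_of n (phi x) in Ux *.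
have /nbhs_ballP[e /= e0 vU] : nbhs v U by exact: open_nbhs_nbhs.
(* Two points of a cube of radius [1/(m+1)] differ by less than [2/(m+1) < e] in each coordinate, so
   a cube containing [v] stays inside [U]. *)
pose m := Num.trunc (2 / e).
have m0 : 0 < (m.+1%:R : R)^-1 by rewrite invr_gt0.
have me : 2 * (m.+1%:R)^-1 < e.
  rewrite -ltr_pdivlMr// invrK -ltr_pdivrMl//.
  by rewrite mulrC; exact: truncnS_gt.
have [q qv] : exists q : {ffun 'I_n -> rat},
    forall i, `|ratr (q i) - v ord0 i| < (m.+1%:R)^-1.
  have /choice[q qv] : forall i, exists q : rat, `|ratr q - v ord0 i| < (m.+1%:R)^-1.
    move=> i; have /rat_in_itvoo[q] : v ord0 i - (m.+1%:R)^-1 < v ord0 i + (m.+1%:R)^-1.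
      by rewrite ltrD2l gtrN.
    by rewrite in_itv/= => ?; exists q; rewrite ltr_distl.
  by exists [ffun i => q i] => i; rewrite ffunE.
exists (q, m) => //; rewrite ifT; first exact: qv.
apply/asboolP => w wq; apply: vU; split=> // i j; rewrite (ord1 i).
rewrite /ball /= -(subrKA (ratr (q j))).
apply: le_lt_trans (ler_normD _ _) _; rewrite distrC.
apply: lt_trans me; rewrite mulr_natl mulr2n; apply: ltrD. exact: qv. exact: wq.
Qed.

Lemma borel_setD n (U V : set 'rV[R]_n) : borel_set U -> borel_set V ->
  borel_set (U `\` V).
Proof. by move=> bU bV d X phi mphi; apply: measurableD; [exact: bU|exact: bV]. Qed.

Lemma borel_cube n (N : R) : borel_set [set v : 'rV[R]_n | forall i, `|v ord0 i| <= N].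
Proof.
move=> d X phi mphi.
rewrite (_ : [set x | _] = [set x | forall i : 'I_n, [set x | `|nth 0 (phi x) i| <= N] x]).
  apply: measurable_forall_ord => i.
  by apply: (measurable_sublevel _ _).2; exact: measurableT_comp.
by apply/seteqP; split => x /= bx i; have := bx i; rewrite mxE.
Qed.

Lemma borel_seq_continuous n (f : 'rV[R]_n -> R) : continuous f ->
  borel_seq n (fun s => (f (row_of n s))%:E).
Proof.
move=> cf d X phi _ mphi; apply/measurable_EFinP.
move=> mX; apply: (measurability _ (RGenOInfty.measurableE R)) => //.
move=> _ [_ [r ->] <-]; rewrite setTI.
have := @open_borel_set n (f @^-1` `]r, +oo[%classic) _ d X phi mphi; apply.
by apply: open_comp => //; apply: interval_open.
Qed.

Lemma borel_seq_indic n (f : 'rV[R]_n -> R) (U : set 'rV[R]_n) : continuous f ->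
  borel_set U -> borel_seq n (fun s => (\1_U (row_of n s) * f (row_of n s))%:E).
Proof.
move=> cf bU d X phi phin mphi; under eq_fun do rewrite EFinM.
apply: emeasurable_funM; last exact: (borel_seq_continuous cf).
apply/measurable_EFinP.
rewrite (_ : (fun x => _) = \1_[set x | U (row_of n (phi x))]).
  by apply: measurable_indic; exact: bU.
by apply/funext => x; rewrite !indicE.
Qed.

Lemma dmeasureE n (f : 'rV[R]_n -> R) A :
  dmeasure f A = iint n (fun s => (\1_A (row_of n s) * f (row_of n s))%:E).
Proof. by []. Qed.

Definition update n (x : 'rV[R]_n) (i : 'I_n) (t : R) : 'rV[R]_n :=
  \row_j (if j == i then t else x ord0 j).

Section unconditional_log_concave.
Variables (n : nat) (f : 'rV[R]_n -> R).
Hypotheses (lcf : log_concave_fun f) (uf : unconditional f).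

(** The new point lies on the segment from [x] to its mirror image in the [i]-th coordinate; [f]
    agrees at both ends, so log-concavity bounds it below by [f x] in between. *)
Lemma unconditional_update_le (x : 'rV[R]_n) i t : `|t| <= `|x ord0 i| -> f x <= f (update x i t).
Proof.
move=> tx; have [x0|x0] := eqVneq (x ord0 i) 0.
  rewrite (_ : update x i t = x)//; apply/rowP => j; rewrite mxE.
  case: eqP => // ->; apply/eqP; rewrite x0 -normr_le0 (le_trans tx)//.
  by rewrite x0 normr0.
set y := update x i (- x ord0 i).
have fy : f y = f x.
  rewrite -(uf (e := \row_j (if j == i then -1 else 1)) _ x).
    congr f; apply/rowP => j; rewrite !mxE; case: eqP => [->|]; first by rewrite mulN1r.
    by rewrite mul1r.
  by move=> j; rewrite mxE; case: eqP; [right|left].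
(* Solves [(1 - l) x_i + l (- x_i) = t]. *)
pose l := (1 - t / x ord0 i) / 2.
have : `|t / x ord0 i| <= 1 by rewrite normf_div ler_pdivrMr ?normr_gt0// mul1r.
rewrite ler_norml => /andP[q1 q2].
have l01 : 0 <= l <= 1.
  by rewrite /l; move: (t / _) q1 q2 => q q1 q2; apply/andP; split; lra.
have := lcf.2 x y l l01; rewrite fy -powRD ?subrK ?oner_eq0// powRr1; last exact: lcf.1.
congr (_ <= f _); apply/rowP => j; rewrite !mxE; case: eqP => [->|_].
  by rewrite /l; field.
by rewrite -mulrDl subrK mul1r.
Qed.

Lemma unconditional_le (x y : 'rV[R]_n) : (forall i, `|y ord0 i| <= `|x ord0 i|) -> f x <= f y.
Proof.
move=> yx.
pose z m : 'rV[R]_n := \row_(j < n) (if (j < m)%N then y ord0 j else x ord0 j).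
have xz m : (m <= n)%N -> f x <= f (z m).
  elim: m => [_|m IH mn]; first by rewrite (_ : z 0 = x)//; apply/rowP => j; rewrite mxE.
  apply: le_trans (IH (ltnW mn)) _.
  have -> : z m.+1 = update (z m) (Ordinal mn) (y ord0 (Ordinal mn)).
    apply/rowP => j; rewrite !mxE -val_eqE /= ltnS leq_eqVlt.
    by case: eqP => //= jm; congr (y _ _); exact: val_inj.
  by apply: unconditional_update_le; rewrite mxE /= ltnn.
have := xz n (leqnn n); rewrite (_ : z n = y)//.
by apply/rowP => j; rewrite mxE ltn_ord.
Qed.

End unconditional_log_concave.

(* Cutting off outside a cube keeps every integral in Prekopa-Leindler finite. *)
Definition truncation n (f : 'rV[R]_n -> R) (N : nat) (s : seq R) : \bar R :=
  (\1_[set v : 'rV[R]_n | forall i, `|v ord0 i| <= N%:R] (row_of n s) * f (row_of n s))%:E.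

Section truncation.
Variables (n : nat) (f : 'rV[R]_n -> R).
Hypotheses (lcf : log_concave_fun f) (uf : unconditional f) (cf : continuous f).

Lemma truncation_in N s : (forall i : 'I_n, `|nth 0 s i| <= N%:R) ->
  truncation f N s = (f (row_of n s))%:E.
Proof.
by move=> sN; rewrite /truncation indicE mem_set ?mul1r//= => i; rewrite mxE.
Qed.

Lemma truncation_out N s (i : 'I_n) : N%:R < `|nth 0 s i| -> truncation f N s = 0%E.
Proof.
move=> sN; rewrite /truncation indicE memNset ?mul0r//= => /(_ i).
by rewrite mxE leNgt sN.
Qed.

Variant truncation_spec N s : \bar R -> Type :=
| TruncationIn of (forall i : 'I_n, `|nth 0 s i| <= N%:R) :
    truncation_spec N s (f (row_of n s))%:E
| TruncationOut (i : 'I_n) of N%:R < `|nth 0 s i| : truncation_spec N s 0%E.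

Lemma truncationP N s : truncation_spec N s (truncation f N s).
Proof.
have [/forallP sN|] := boolP [forall i : 'I_n, `|nth 0 s i| <= N%:R].
  by rewrite truncation_in//; constructor.
rewrite negb_forall => /existsP/sigW[i]; rewrite -ltNge => sN.
by rewrite (truncation_out sN); apply: (@TruncationOut _ _ i).
Qed.

Lemma truncation_ge0 N s : (0 <= truncation f N s)%E.
Proof. by case: truncationP => // _; rewrite lee_fin lcf.1. Qed.

Lemma truncation_le N s : (truncation f N s <= (f (row_of n s))%:E)%E.
Proof. by case: truncationP => // *; rewrite lee_fin lcf.1. Qed.

Lemma truncation_nondecreasing s : nondecreasing_seq (truncation f ^~ s).
Proof.
move=> M N MN; case: (truncationP M) => [sM|*]; last exact: truncation_ge0.
by rewrite truncation_in// => i; rewrite (le_trans (sM i))// ler_nat.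
Qed.

Lemma truncation_near s :
  \forall N \near \oo, truncation f N s = (f (row_of n s))%:E.
Proof.
near=> N; rewrite truncation_in// => i.
apply: (@le_trans _ _ (\sum_(j < n) `|nth 0 s j|)).
  by rewrite (bigD1 i)//= lerDl sumr_ge0.
by near: N; exact: nbhs_infty_ger.
Unshelve. all: by end_near. Qed.

Lemma tame_truncation N : tame n N%:R (f 0) (truncation f N).
Proof.
have f_le x : f x <= f 0 by apply: unconditional_le => // i; rewrite mxE normr0.
split.
- exact: (borel_seq_indic cf (@borel_cube n N%:R)).
- exact: truncation_ge0.
- by move=> s _; case: truncationP => *; rewrite lee_fin// lcf.1.
- move=> s s' _ _ ss'; case: truncationP => [sN|*]; last exact: truncation_ge0.
  rewrite truncation_in; last by move=> i; exact: le_trans (ss' i) (sN i).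
  by rewrite lee_fin; apply: unconditional_le => // i; rewrite !mxE.
- move=> s j sn Ns; have jn : (j < n)%N.
    rewrite ltnNge; apply/negP => nj.
    by move: Ns; rewrite nth_default ?sn// normr0 ltNge ler0n.
  exact: (truncation_out (i := Ordinal jn)).
Qed.

(** The cube is convex, so inside it this is log-concavity of [f]; if [x] or [y] is outside, the
    left side is 0 because both exponents are positive. *)
Lemma interpolates_truncation N l : 0 < l < 1 ->
  interpolates n (truncation f N) (truncation f N) (truncation f N) l.
Proof.
move=> /andP[l0 l1] x y z _ _ _ xyz.
have h0 : 0 <= fine (truncation f N z) by rewrite fine_ge0// truncation_ge0.
case: (truncationP N x) => [xN|*]; last by rewrite /= powR0 ?mul0r// gt_eqF// subr_gt0.
case: (truncationP N y) => [yN|*]; last by rewrite /= powR0 ?mulr0// gt_eqF.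
rewrite truncation_in /=; last first.
  move=> i; rewrite xyz; apply: le_trans (ler_normD _ _) _; rewrite !normrM.
  rewrite (gtr0_norm l0) (@gtr0_norm _ (1 - l)) ?subr_gt0//.
  have -> : N%:R = (1 - l) * N%:R + l * N%:R :> R by rewrite -mulrDl subrK mul1r.
  by apply: lerD; apply: ler_wpM2l => //; rewrite ?subr_ge0 ltW.
rewrite (_ : row_of n z = (1 - l) *: row_of n x + l *: row_of n y).
  by apply: lcf.2; rewrite !ltW.
by apply/rowP => i; rewrite !mxE xyz.
Qed.

End truncation.

(** The left side is the [i]-th marginal at 0. Its finiteness is not known beforehand, so the bound
    is proved for truncations and passed to the limit. *)
Lemma section_density_le k (f : 'rV[R]_k.+1 -> R) (i : 'I_k.+1) :
  prob_density f -> log_concave_fun f -> isotropic f -> unconditional f -> continuous f ->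
  (iint k (fun s => (f (row_of k.+1 (insert_at i 0 s)))%:E) <= ((Num.sqrt 2)^-1)%:E)%E.
Proof.
move=> pf lcf isof uf cf.
have ik : (i <= k)%N by rewrite -ltnS.
have T N := tame_truncation lcf uf cf N.
have f0 x : 0 <= f x by exact: lcf.1.
have c0 N s : (0 <= truncation f N (insert_at i 0 s))%E by exact: truncation_ge0.
pose c N := iint k (fun s => truncation f N (insert_at i 0 s)).
pose J N := iint k.+1 (fun s => (nth 0%R s i ^+ 2)%:E * truncation f N s)%E.
have j0 N s : (0 <= (nth 0%R s i ^+ 2)%:E * truncation f N s)%E.
  by rewrite mule_ge0 ?truncation_ge0// lee_fin sqr_ge0.
have cN : c N @[N --> \oo] --> iint k (fun s => (f (row_of k.+1 (insert_at i 0 s)))%:E).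
  apply: cvg_iint => //.
  - by move=> N; case: (tame_insert 0 ik (T N)).
  - by move=> s; apply: (truncation_nondecreasing lcf).
  - by move=> s; apply: cvg_near_cst; exact: truncation_near.
have JN : J N @[N --> \oo] --> 1%E.
  have := isof.2 i i; rewrite eqxx => <-.
  apply: cvg_iint => //.
  - move=> N d X u uk mu_; have [bT _ _ _ _] := T N; apply: emeasurable_funM; last exact: bT.
    by apply/measurable_EFinP; exact: measurable_funX.
  - move=> s M N MN /=; apply: lee_wpmul2l; first by rewrite lee_fin sqr_ge0.
    exact: truncation_nondecreasing.
  - move=> s; apply: cvg_near_cst; near=> N.
    rewrite (_ : truncation f N s = (f (row_of k.+1 s))%:E); last first.
      by near: N; exact: truncation_near.
    by rewrite -EFinM !mxE -expr2.
have J1 N : (J N <= 1)%E.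
  have := isof.2 i i; rewrite eqxx => <-; apply: le_iint => // s _.
  rewrite !mxE -expr2 [leRHS]EFinM; apply: lee_wpmul2l; first by rewrite lee_fin sqr_ge0.
  exact: truncation_le.
have Jfin N : J N \is a fin_num.
  by rewrite ge0_fin_numE ?iint_ge0// (le_lt_trans (J1 N))// ltry.
have cfin N : c N \is a fin_num.
  by apply: (tame_iint_fin (ler0n R N) (f0 0)); exact: tame_insert.
have JM M N : (M <= N)%N -> fine (J M) <= fine (J N).
  move=> MN; apply: fine_le => //; apply: le_iint => // s _.
  apply: lee_wpmul2l; first by rewrite lee_fin sqr_ge0.
  exact: truncation_nondecreasing.
have cM M N : (M <= N)%N -> fine (c M) <= fine (c N).
  move=> MN; apply: fine_le => //; apply: le_iint => // s _.
  exact: truncation_nondecreasing.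
have c0' N : 0 <= fine (c N) by rewrite fine_ge0// iint_ge0.
have J0' N : 0 <= fine (J N) by rewrite fine_ge0// iint_ge0.
have diag N : 2 * fine (c N) ^+ 2 * fine (J N) <= 1.
  apply: le_trans (section_second_moment_le ik (ler0n R N) (f0 0) (T N)
    (fun l => @interpolates_truncation _ _ lcf N l)) _.
  have I1 : (iint k.+1 (truncation f N) <= 1)%E.
    rewrite -pf.2; apply: le_iint => s; first exact: truncation_ge0.
    by move=> _; exact: truncation_le.
  have I0 : (0 <= iint k.+1 (truncation f N))%E.
    by apply: iint_ge0 => s; exact: truncation_ge0.
  rewrite exprn_ile1 ?fine_ge0// -lee_fin fineK//.
  by rewrite ge0_fin_numE// (le_lt_trans I1)// ltry.
(* The two indices are decoupled: for [M >= N], [2 (c N)^2 J M <= 2 (c M)^2 J M <= 1]. Letting only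
   [M] grow sends [J M] to 1 and avoids a product of limits. *)
have cle N : 2 * fine (c N) ^+ 2 <= 1.
  rewrite leNgt; apply/negP => cN1.
  have q0 : 0 < 2 * fine (c N) ^+ 2 by exact: lt_trans cN1.
  have : (1 <= ((2 * fine (c N) ^+ 2)^-1)%:E)%E.
    apply: (cvge_to_le JN); near=> M.
    have NM : (N <= M)%N by near: M; exact: nbhs_infty_ge.
    rewrite -(fineK (Jfin M)) lee_fin -[leRHS]mulr1 ler_pdivlMl//.
    apply: le_trans (diag M); apply: ler_wpM2r => //; apply: ler_wpM2l => //.
    by rewrite ler_sqr ?nnegrE// cM.
  by rewrite lee_fin leNgt invf_lt1 ?cN1.
apply: (cvge_to_le cN); near=> N.
rewrite -(fineK (cfin N)) lee_fin -ler_sqr ?nnegrE ?invr_ge0 ?sqrtr_ge0//.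
by rewrite exprVn sqr_sqrtr// -[leRHS]mulr1 ler_pdivlMl.
Unshelve. all: by end_near. Qed.

End density.

(** * Enlargements of convex sets *)

Section convex_interior.
Context {R : realType}.
Set Implicit Arguments.
Unset Strict Implicit.

Lemma nbhs_rowP n (p : 'rV[R]_n) (U : set 'rV[R]_n) :
  nbhs p U <-> exists2 e : R, 0 < e & forall x : 'rV[R]_n, (forall i, `|x ord0 i - p ord0 i| < e) -> U x.
Proof.
split=> [/nbhs_ballP[e /= e0 pU]|[e e0 pU]].
  exists e => // x px; apply: pU; split => // i j; rewrite (ord1 i).
  by rewrite /ball /= distrC; exact: px.
apply/nbhs_ballP; exists e => //= x [_ px]; apply: pU => i.
by have := px ord0 i; rewrite /ball /= distrC.
Qed.

(** The missing weight [1 - sum c] sits on [x0]. The induction splits off one point and rescales the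
    other weights by [1 / (1 - c i)]. *)
Lemma convex_subset_simplex n (A : set 'rV[R]_n) x0 (I : eqType) (r : seq I)
    (c : I -> R) (v : I -> 'rV[R]_n) :
  convex_subset A -> A x0 -> (forall i, A (x0 + v i)) ->
  (forall i, 0 <= c i) -> \sum_(i <- r) c i < 1 ->
  A (x0 + \sum_(i <- r) c i *: v i).
Proof.
move=> cA A0 Av; elim: r c => [|i r IH] c c0 c1; first by rewrite big_nil addr0.
rewrite !big_cons in c1 *.
have s0 : 0 <= \sum_(j <- r) c j by apply: sumr_ge0.
have ci1 : c i < 1 by apply: le_lt_trans c1; rewrite lerDl.
have d0 : 0 < 1 - c i by rewrite subr_gt0.
have := cA _ _ (IH (fun j => c j / (1 - c i)) _ _) (Av i) (c i) _.
rewrite c0 ltW// => /(_ _ _ isT) H.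
have -> : x0 + (c i *: v i + \sum_(j <- r) c j *: v j) =
    (1 - c i) *: (x0 + \sum_(j <- r) (c j / (1 - c i)) *: v j) + c i *: (x0 + v i).
  rewrite !scalerDr scaler_sumr.
  under [in RHS]eq_bigr do rewrite scalerA mulrC divfK ?gt_eqF//.
  rewrite addrACA -scalerDl subrK scale1r; congr (_ + _).
  by rewrite addrC.
apply: H; first by move=> j; rewrite divr_ge0// ltW.
by rewrite -mulr_suml ltr_pdivrMr// mul1r ltrBrDl.
Qed.

(** Take a matrix [M] of maximal rank whose rows are differences from [x0] to points of [A]. If the
    rank is not full, a nonzero column of the cokernel is normal to a hyperplane containing [A]; if
    it is full, [A] contains a simplex-like neighbourhood. *)
Lemma convex_interior_or_hyperplane n (A : set 'rV[R]_n) (x0 : 'rV[R]_n) :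
  convex_subset A -> A x0 ->
  A° !=set0 \/ exists (a : 'I_n -> R) (c : R), (exists i, a i != 0) /\
    forall x : 'rV[R]_n, A x -> \sum_i x ord0 i * a i = c.
Proof.
move=> cA A0.
pose P r := `[< exists m (M : 'M[R]_(m, n)), (r <= \rank M)%N /\
  forall i, A (x0 + row i M) >].
have P0 : exists r, P r.
  by exists 0%N; apply/asboolP; exists 0%N, 0; split => // -[].
have Pn r : P r -> (r <= n)%N.
  by move=> /asboolP[m [M [rM _]]]; rewrite (leq_trans rM)// rank_leq_col.
case: (ex_maxnP P0 Pn) => r /asboolP[m [M [rM AM]]] rmax.
(* Otherwise [x - x0] could be appended to [M] as a new row, raising the maximal rank. *)
have xM x : A x -> (x - x0) *m cokermx M = 0.
  move=> Ax; apply/eqP; rewrite -submxE; apply/negPn/negP => xM.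
  have : P r.+1.
    apply/asboolP; exists (m + 1)%N, (col_mx M (x - x0)); split; last first.
      move=> i; case: (split_ordP i) => j ->.
        by rewrite rowKu; exact: AM.
      by rewrite rowKd row_id addrC subrK.
    apply: (leq_ltn_trans rM); rewrite -addsmxE; apply: rank_ltmx.
    rewrite /ltmx addsmxSl/=; apply: contra xM; apply: submx_trans; exact: addsmxSr.
  by move=> /rmax; rewrite ltnn.
have [fM|] := boolP (row_full M); last first.
  rewrite -cokermx_eq0 => K0; right.
  have [i [j Kij]] : exists i j, cokermx M i j != 0.
    apply: contrapT => /forallNP K; move/negP: K0; apply; apply/eqP/matrixP => i j.
    by rewrite [RHS]mxE; apply: contrapT => /eqP ij; apply: (K i); exists j.
  exists (fun i => cokermx M i j), (\sum_i x0 ord0 i * cokermx M i j); split; first by exists i.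
  move=> x /xM /matrixP/(_ ord0 j); rewrite !mxE => E.
  apply/eqP; rewrite -subr_eq0 -sumrB -[X in _ == X]E; apply/eqP/eq_bigr => l _.
  by rewrite !mxE mulrBl.
left.
(* [M] may have more rows than columns; the pseudo-inverse picks one way of writing [x - p] in its
   rows. [K] bounds the effect of [N], so the radius [d^2 / K] gives [|u i| <= d^2]. *)
pose N := pinvmx M.
pose K : R := 1 + \sum_i \sum_j `|N j i|.
have K0 : 0 < K by rewrite ltr_pwDl// !sumr_ge0// => i _; rewrite sumr_ge0.
(* With this [d] the weights [d + u i] are nonnegative, as [d^2 <= d], and add up to at most
   [m (d + d^2) = 1 - d^2 < 1]. *)
pose d : R := (m.+1%:R)^-1.
have d0 : 0 < d by rewrite invr_gt0.
have d1 : d <= 1 by rewrite invf_le1// ler1n.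
pose p := x0 + \sum_(i < m) d *: row i M.
exists p; apply/nbhs_rowP; exists (d ^+ 2 / K); first by rewrite divr_gt0// exprn_gt0.
move=> x xp.
pose u i := ((x - p) *m N) ord0 i.
have u_le i : `|u i| <= d ^+ 2.
  rewrite /u mxE; apply: le_trans (ler_norm_sum _ _ _) _.
  apply: (@le_trans _ _ (\sum_j d ^+ 2 / K * `|N j i|)).
    apply: ler_sum => j _; rewrite normrM ler_wpM2r//.
    by have := xp j; rewrite !mxE => /ltW.
  rewrite -mulr_sumr -mulrA ler_piMr ?sqr_ge0//.
  rewrite mulrC ler_pdivrMr// mul1r /K (bigD1 i)//= addrCA.
  by rewrite lerDl addr_ge0// sumr_ge0// => l _; rewrite sumr_ge0.
have -> : x = x0 + \sum_(i <- index_enum 'I_m) (d + u i) *: row i M.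
  under eq_bigr do rewrite scalerDl.
  rewrite big_split/= addrA -/p.
  have -> : \sum_(i < m) u i *: row i M = x - p.
    rewrite -[RHS](mulmxKpV (_ : (x - p <= M)%MS)).
      by rewrite mulmx_sum_row.
    by rewrite submx_full.
  by rewrite addrC subrK.
apply: convex_subset_simplex => //.
- move=> i; have := u_le i; rewrite ler_norml => /andP[ui _].
  have : d ^+ 2 <= d by rewrite expr2 ler_piMl// ltW.
  lra.
- apply: (@le_lt_trans _ _ (\sum_(i < m) (d + d ^+ 2))).
    by apply: ler_sum => i _; rewrite lerD2l (le_trans (ler_norm _))// u_le.
  rewrite sumr_const card_ord -[_ *+ m]mulr_natl.
  have -> : m%:R = d^-1 - 1 :> R by rewrite invrK -natr1 addrK.
  rewrite (_ : _ * _ = 1 - d ^+ 2); first by rewrite ltrBlDr ltrDl exprn_gt0.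
  by field; rewrite gt_eqF.
Qed.

(** The homothety of centre [x] and ratio [l] maps a neighbourhood of [u] inside [A] onto a
    neighbourhood of the mixed point; [w] is the preimage of [y]. *)
Lemma convex_interior_mix n (A : set 'rV[R]_n) x u l :
  convex_subset A -> A x -> A° u -> 0 < l <= 1 -> A° ((1 - l) *: x + l *: u).
Proof.
move=> cA Ax /nbhs_rowP[e e0 uA] /andP[l0 l1].
apply/nbhs_rowP; exists (l * e); first by rewrite mulr_gt0.
move=> y yx.
pose w := u + l^-1 *: (y - ((1 - l) *: x + l *: u)).
have -> : y = (1 - l) *: x + l *: w.
  by rewrite /w scalerDr scalerA mulfV ?gt_eqF// scale1r addrA addrC subrK.
apply: cA => //; last by rewrite ltW.
apply: uA => i.
rewrite (_ : _ - _ = l^-1 * (y ord0 i - ((1 - l) * x ord0 i + l * u ord0 i))); last first.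
  by rewrite !mxE; ring.
rewrite normrM gtr0_norm ?invr_gt0//.
by rewrite ltr_pdivrMl//; have := yx i; rewrite !mxE.
Qed.

Lemma convex_interior n (A : set 'rV[R]_n) : convex_subset A -> convex_subset A°.
Proof.
move=> cA x y Ax Ay l /andP[l0 l1].
move: l0; rewrite le_eqVlt => /predU1P[<-|l0].
  by rewrite subr0 scale1r scale0r addr0.
by apply: convex_interior_mix => //; [exact: interior_subset|rewrite l0].
Qed.

End convex_interior.

(** * Sections by lines parallel to an axis, and thickening along one axis at a time *)

Section line_sections.
Context {R : realType}.
Set Implicit Arguments.
Unset Strict Implicit.
Notation mu := (@lebesgue_measure R).

Lemma update_row_of k (i : 'I_k.+1) t (s : seq R) : size s = k ->
  row_of k.+1 (insert_at i t s) = update (row_of k.+1 (insert_at i 0 s)) i t.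
Proof.
move=> sk; have ik : (i <= size s)%N by rewrite sk -ltnS.
apply/rowP => j; rewrite !mxE !nth_insert_at// -val_eqE /=.
by case: ltngtP.
Qed.

Lemma measurable_section n (W : set 'rV[R]_n) v i :
  borel_set W -> measurable [set t | W (update v i t)].
Proof.
move=> bW.
have := bW _ R (fun t => [seq update v i t ord0 j | j <- enum 'I_n]).
have E t : row_of n [seq update v i t ord0 j | j <- enum 'I_n] = update v i t.
  apply/rowP => j; rewrite mxE (nth_map j) ?size_enum_ord//.
  by rewrite nth_ord_enum.
under eq_set do rewrite E.
apply => j; have [jn|nj] := ltnP j n; last first.
  rewrite (_ : (fun t => _) = cst 0); first exact: measurable_cst.
  by apply/funext => t; rewrite nth_default// size_map size_enum_ord.
rewrite (_ : (fun t => _) = fun t => update v i t ord0 (Ordinal jn)).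
  by under eq_fun do rewrite mxE; case: (Ordinal jn == i); [exact: measurable_id|exact: measurable_cst].
apply/funext => t; rewrite (nth_map (Ordinal jn)) ?size_enum_ord//.
by rewrite (nth_ord_enum _ (Ordinal jn)).
Qed.

Section density.
Variables (k : nat) (f : 'rV[R]_k.+1 -> R).
Hypotheses (pf : prob_density f) (lcf : log_concave_fun f) (isof : isotropic f)
  (uf : unconditional f) (cf : continuous f).

(** The geometry of [W] enters only through the length [L], which serves both a thickening step
    ([L = 2 r]) and a slab ([L = 2 n eps]). *)
Lemma dmeasure_section_le (W : set 'rV[R]_k.+1) (i : 'I_k.+1) (L : R) : 0 <= L ->
  borel_set W -> (forall v, mu [set t | W (update v i t)] <= L%:E)%E ->
  (dmeasure f W <= (L / Num.sqrt 2)%:E)%E.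
Proof.
move=> L0 bW WL; have ik : (i <= k)%N by rewrite -ltnS.
have f0 x : 0 <= f x by exact: lcf.1.
have Wf0 s : (0 <= (\1_W (row_of k.+1 s) * f (row_of k.+1 s))%:E)%E.
  by rewrite lee_fin mulr_ge0.
have bf := borel_seq_continuous cf.
rewrite dmeasureE (iint_insert_in ik Wf0 (borel_seq_indic cf bW)).
apply: (@le_trans _ _ (iint k (fun s => L%:E * (f (row_of k.+1 (insert_at i 0 s)))%:E))%E).
  apply: le_iint => s; first by apply: integral_ge0.
  move=> sk; set v := row_of k.+1 (insert_at i 0 s).
  have mW := measurable_section v i bW.
  apply: (@le_trans _ _ (\int[mu]_t ((f v)%:E * (\1_[set t | W (update v i t)] t)%:E))%E).
    apply: le_lower_integral => t //.
    rewrite update_row_of// -/v -EFinM lee_fin mulrC !indicE.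
    have -> : (t \in [set t | W (update v i t)]) = (update v i t \in W).
      by apply/idP/idP; rewrite !inE.
    rewrite ler_wpM2r// unconditional_le// => j; rewrite [update _ _ _ _ _]mxE; case: eqP => // ->.
    by rewrite !mxE nth_insert_at ?sk// ltnn eqxx normr0.
  rewrite ge0_integralZl_EFin//; last first.
    by apply/measurable_EFinP; exact: measurable_indic.
  rewrite integral_indic// setIT muleC; apply: lee_wpmul2r; first by rewrite lee_fin.
  exact: WL.
rewrite iintZl//; [|by move=> s; rewrite lee_fin|exact: (borel_seq_insert 0 ik bf)].
by rewrite EFinM; apply: lee_wpmul2l => //; exact: section_density_le.
Qed.

End density.

(** A point outside the interval [J] has all of [J] on one side, so [E] lies in two intervals of
    length [r], one attached to each end of [J]. *)
Lemma measure_thickened_interval_le (J E : set R) (r : R) : 0 < r -> is_interval J ->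
  measurable E -> (forall t, E t -> ~ J t /\ exists2 u, J u & `|t - u| < r) ->
  (mu E <= (2 * r)%:E)%E.
Proof.
move=> r0 iJ mE EJ.
(* If [E] has a point to the right of [J], then [J] is bounded above and [b] is its supremum;
   otherwise the condition is vacuous and 0 serves. The left end is symmetric. *)
have [b Eb] : exists b, forall t, E t -> (exists2 u, J u & u < t) -> b <= t <= b + r.
  have [[t0 [Et0 [u0 Ju0 u0t]]]|no] := pselect (exists t, E t /\ exists2 u, J u & u < t).
    have ubJ t u0' : E t -> J u0' -> u0' < t -> ubound J t.
      move=> Et Ju0' u0't w Jw; rewrite leNgt; apply/negP => tw.
      by apply: (EJ _ Et).1; apply: (iJ _ _ Ju0' Jw); rewrite !ltW.
    have hJ : has_sup J by split; [exists u0|exists t0; exact: (ubJ _ u0)].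
    exists (sup J) => t Et [u Ju ut]; apply/andP; split.
      by apply: ge_sup; [exists u|exact: (ubJ _ u)].
    have [_ [w Jw tw]] := EJ _ Et.
    rewrite -lerBlDr (@le_trans _ _ w)//; last by apply: ub_le_sup => //; exact: hJ.2.
    by move: tw; rewrite ltr_norml => /andP[_]; lra.
  by exists 0 => t Et tu; exfalso; apply: no; exists t.
have [a Ea] : exists a, forall t, E t -> (exists2 u, J u & t < u) -> a - r <= t <= a.
  have [[t0 [Et0 [u0 Ju0 u0t]]]|no] := pselect (exists t, E t /\ exists2 u, J u & t < u).
    have lbJ t u0' : E t -> J u0' -> t < u0' -> lbound J t.
      move=> Et Ju0' u0't w Jw; rewrite leNgt; apply/negP => tw.
      by apply: (EJ _ Et).1; apply: (iJ _ _ Jw Ju0'); rewrite !ltW.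
    have hJ : has_inf J by split; [exists u0|exists t0; exact: (lbJ _ u0)].
    exists (inf J) => t Et [u Ju ut]; apply/andP; split; last first.
      by apply: lb_le_inf; [exists u|exact: (lbJ _ u)].
    have [_ [w Jw tw]] := EJ _ Et.
    rewrite lerBlDr (@le_trans _ _ w)//; first by apply: ge_inf => //; exact: hJ.2.
    by move: tw; rewrite ltr_norml => /andP[+ _]; lra.
  by exists 0 => t Et tu; exfalso; apply: no; exists t.
apply: (@le_trans _ _ (mu (`[b, (b + r)]%classic `|` `[(a - r), a]%classic))).
  apply: le_measure; rewrite ?inE//; first exact: measurableU.
  move=> t Et; have [nJ [u Ju tu]] := EJ _ Et.
  have [ut|ut|tu'] := ltgtP t u.
  - by right; rewrite /= in_itv/=; apply: Ea => //; exists u.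
  - by left; rewrite /= in_itv/=; apply: Eb => //; exists u.
  - by move: nJ; rewrite tu'.
apply: (@le_trans _ _ (mu `[b, (b + r)%R]%classic + mu `[(a - r)%R, a]%classic)%E).
  exact: measureU2.
rewrite !lebesgue_measure_itv/= !lte_fin ltrDl r0 ltrBlDr ltrDl r0 -!EFinB -EFinD lee_fin.
lra.
Qed.

(** The sum of [C] and an open box of half-width [r] along the first [m] axes, flat along the
    others: it passes from [C] at [m = 0] to [C] plus an open cube at [m = n]. *)
Definition thicken n (C : set 'rV[R]_n) (r : R) (m : nat) : set 'rV[R]_n :=
  [set x : 'rV[R]_n | exists2 u : 'rV[R]_n, C u & forall j : 'I_n,
     if (j < m)%N then `|x ord0 j - u ord0 j| < r : Prop
     else x ord0 j = u ord0 j].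

Section thicken.
Variables (n : nat) (C : set 'rV[R]_n) (r : R).
Hypothesis r0 : 0 < r.

Lemma thicken0 : thicken C r 0 = C.
Proof.
apply/seteqP; split=> x.
  by move=> [u Cu xu]; rewrite (_ : x = u)//; apply/rowP => j; exact: xu.
by move=> Cx; exists x.
Qed.

(** A small displacement of [x] is matched by the same displacement of its witness [u]. *)
Lemma open_thicken m : open C -> open (thicken C r m).
Proof.
rewrite !openE => oC x [u Cu xu]; have /nbhs_rowP[e e0 uC] := oC u Cu.
apply/nbhs_rowP; exists e => // y yx; exists (u + (y - x)).
  apply: uC => j; rewrite (_ : _ - _ = y ord0 j - x ord0 j) ?yx//.
  by rewrite !mxE; ring.
move=> j; have := xu j; case: ifP => _.
  by rewrite !mxE; congr (`|_| < _); ring.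
by rewrite !mxE => ->; ring.
Qed.

Lemma convex_thicken m : convex_subset C -> convex_subset (thicken C r m).
Proof.
move=> cC x y [u Cu xu] [v Cv yv] l l01; exists ((1 - l) *: u + l *: v); first exact: cC.
move=> j; have := xu j; have := yv j; case: ifP => _; rewrite !mxE; last by move=> -> ->.
move=> yvr xur.
have -> : (1 - l) * x ord0 j + l * y ord0 j - ((1 - l) * u ord0 j + l * v ord0 j) =
  (1 - l) * (x ord0 j - u ord0 j) + l * (y ord0 j - v ord0 j) by ring.
case/andP: l01 => l0 l1; apply: le_lt_trans (ler_normD _ _) _.
rewrite !normrM (ger0_norm l0) (@ger0_norm _ (1 - l)) ?subr_ge0//.
(* Bounding both distances by their maximum keeps the inequality strict even at [l = 0] and
   [l = 1]. *)
have lt_max : Num.max `|x ord0 j - u ord0 j| `|y ord0 j - v ord0 j| < r.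
  by rewrite gt_max xur.
apply: le_lt_trans lt_max; set M := Num.max _ _.
rewrite (_ : M = (1 - l) * M + l * M); last by ring.
by apply: lerD; apply: ler_wpM2l; rewrite ?subr_ge0// le_max lexx ?orbT.
Qed.

Lemma is_interval_section m v i : convex_subset C ->
  is_interval [set t | thicken C r m (update v i t)].
Proof.
move=> cC x y /= Vx Vy z /andP[xz zy].
have [xy|xy] := eqVneq x y.
  by have -> : z = x by apply/eqP; rewrite eq_le xz xy zy.
have xy0 : 0 < y - x by rewrite subr_gt0 lt_neqAle xy (le_trans xz).
have := convex_thicken cC Vx Vy (l := (z - x) / (y - x)) _.
rewrite (_ : _ + _ = update v i z).
  by apply; rewrite divr_ge0 ?subr_ge0 ?(le_trans xz)//= ler_pdivrMr// mul1r lerB.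
apply/rowP => j; rewrite !mxE; case: eqP => _; first by field; rewrite gt_eqF.
by rewrite -mulrDl subrK mul1r.
Qed.

Lemma thicken_section m v (i : 'I_n) t : i = m :> nat ->
  thicken C r m.+1 (update v i t) ->
  exists2 t', thicken C r m (update v i t') & `|t - t'| < r.
Proof.
move=> im [u Cu xu]; exists (u ord0 i).
  exists u => // j; have := xu j; rewrite !mxE; case: eqP => [->|/eqP ji].
    by rewrite im ltnn.
  have jm : (nat_of_ord j == m) = false by rewrite -im val_eqE; apply/negbTE.
  by rewrite ltnS leq_eqVlt jm.
by have := xu i; rewrite im ltnSn mxE eqxx.
Qed.

End thicken.

Lemma enorm_ge n (b : 'rV[R]_n) i : `|b ord0 i| <= enorm b.
Proof.
rewrite -sqrtr_sqr ler_wsqrtr// (bigD1 i)//= lerDl sumr_ge0// => j _.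
exact: sqr_ge0.
Qed.

(** * Mass of the boundary layer of a convex set *)

Section boundary.
Variables (k : nat) (f : 'rV[R]_k.+1 -> R).
Hypotheses (pf : prob_density f) (lcf : log_concave_fun f) (isof : isotropic f)
  (uf : unconditional f) (cf : continuous f).

(** Valid for arbitrary sets, so a possibly non-Borel [enlarge A eps] minus [A] may be replaced by a
    Borel superset. *)
Lemma le_dmeasure (A B : set 'rV[R]_k.+1) : A `<=` B -> (dmeasure f A <= dmeasure f B)%E.
Proof.
move=> AB; rewrite !dmeasureE; apply: le_iint => s; first by rewrite lee_fin mulr_ge0 ?lcf.1.
move=> _; rewrite lee_fin ler_wpM2r ?lcf.1// !indicE ler_nat.
case: (boolP (_ \in A)) => //; rewrite inE => /AB sB.
by rewrite mem_set.
Qed.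

Lemma dmeasureU_le (A B : set 'rV[R]_k.+1) : borel_set A -> borel_set B ->
  (dmeasure f (A `|` B) <= dmeasure f A + dmeasure f B)%E.
Proof.
move=> bA bB; rewrite !dmeasureE -iintD.
- apply: le_iint => s; first by rewrite lee_fin mulr_ge0 ?lcf.1.
  move=> _; rewrite -EFinD lee_fin -mulrDl ler_wpM2r ?lcf.1// !indicE -natrD ler_nat.
  case: (boolP (_ \in A `|` B)) => //; rewrite inE => -[sA|sB].
    by rewrite (mem_set sA).
  by rewrite (mem_set sB) addn1.
- by move=> s; rewrite lee_fin mulr_ge0 ?lcf.1.
- by move=> s; rewrite lee_fin mulr_ge0 ?lcf.1.
- exact: borel_seq_indic.
- exact: borel_seq_indic.
Qed.

Lemma dmeasure_thicken_step C r m : 0 < r -> open C -> convex_subset C -> (m < k.+1)%N ->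
  (dmeasure f (thicken C r m.+1 `\` thicken C r m) <= (2 * r / Num.sqrt 2)%:E)%E.
Proof.
move=> r0 oC cC mk.
have bV j : borel_set (thicken C r j) by apply: open_borel_set; exact: open_thicken.
have bD : borel_set (thicken C r m.+1 `\` thicken C r m) by exact: borel_setD.
apply: (@dmeasure_section_le _ _ pf lcf isof uf cf _ (Ordinal mk)) => //.
  by rewrite mulr_ge0// ltW.
move=> v; apply: (measure_thickened_interval_le r0
    (J := [set t | thicken C r m (update v (Ordinal mk) t)])).
- exact: is_interval_section.
- exact: (measurable_section v _ bD).
move=> t /= [tV ntV]; split => //.
by have [t' ? ?] := thicken_section (i := Ordinal mk) erefl tV; exists t'.
Qed.

Lemma dmeasure_thicken C r m : 0 < r -> open C -> convex_subset C -> (m <= k.+1)%N ->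
  (dmeasure f (thicken C r m `\` C) <= (m%:R * (2 * r / Num.sqrt 2))%:E)%E.
Proof.
move=> r0 oC cC.
have bV j : borel_set (thicken C r j) by apply: open_borel_set; exact: open_thicken.
elim: m => [_|m IH mk].
  rewrite thicken0 setDv mul0r dmeasureE.
  apply: (@le_trans _ _ (iint k.+1 (fun=> 0%E))); last by rewrite iint0.
  apply: le_iint => s.
    by rewrite lee_fin mulr_ge0 ?lcf.1.
  by move=> _; rewrite indicE in_set0 mul0r.
apply: (@le_trans _ _ (dmeasure f ((thicken C r m `\` thicken C r 0) `|`
    (thicken C r m.+1 `\` thicken C r m)))).
  apply: le_dmeasure => x [xV nxC].
  have [xm|xm] := pselect (thicken C r m x); last by right.
  by left; split => //; rewrite thicken0.
apply: le_trans (dmeasureU_le _ _) _; [exact: borel_setD..|].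
rewrite -natr1 mulrDl mul1r EFinD; apply: leeD; last exact: dmeasure_thicken_step.
by rewrite thicken0; apply: IH; exact: ltnW.
Qed.

Lemma borel_slab (a : 'I_k.+1 -> R) (c d : R) :
  borel_set [set x : 'rV[R]_k.+1 | `|\sum_i x ord0 i * a i - c| <= d].
Proof.
move=> e X phi mphi.
rewrite (_ : [set x | _] = [set x | `|\sum_(i < k.+1) nth 0 (phi x) i * a i - c| <= d]).
  apply: (measurable_sublevel _ _).2; apply: measurableT_comp => //.
  apply: measurable_funB => //; apply: measurable_sum => j.
  exact: measurable_funM.
have E x : \sum_i row_of k.+1 (phi x) ord0 i * a i = \sum_(i < k.+1) nth 0 (phi x) i * a i.
  by apply: eq_bigr => i _; rewrite mxE.
by apply/seteqP; split=> x /=; rewrite E.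
Qed.

(** Cut along the axis where [|a i|] is largest: then [sum |a j| <= n |a i|], with [n = k.+1], and
    each section lies in an interval of half-length [n eps]. *)
Lemma dmeasure_slab_le (a : 'I_k.+1 -> R) (c eps : R) : 0 < eps -> (exists i, a i != 0) ->
  (dmeasure f [set x : 'rV[R]_k.+1 | `|\sum_i x ord0 i * a i - c| <= eps * \sum_i `|a i|]%R
    <= (2 * (k.+1%:R * eps) / Num.sqrt 2)%:E)%E.
Proof.
move=> eps0 [i0 ai0].
pose i := [arg max_(j > i0) `|a j|]%O.
have aM j : `|a j| <= `|a i|.
  by rewrite /i; case: arg_maxP => // i1 _; exact.
have ai : 0 < `|a i| by rewrite (lt_le_trans _ (aM i0))// normr_gt0.
have ai_neq0 : a i != 0 by rewrite -normr_gt0.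
have asum : \sum_j `|a j| <= k.+1%:R * `|a i|.
  apply: (@le_trans _ _ (\sum_(j < k.+1) `|a i|)); first exact: ler_sum.
  by rewrite sumr_const card_ord mulr_natl.
have L0 : 0 <= k.+1%:R * eps by rewrite mulr_ge0// ltW.
apply: (@dmeasure_section_le _ _ pf lcf isof uf cf _ i); first by rewrite mulr_ge0.
  exact: borel_slab.
(* [b] is the coordinate at which the line meets the central hyperplane of the slab. *)
move=> v; pose b := (c - \sum_(j | j != i) v ord0 j * a j) / a i.
apply: (@le_trans _ _ (mu `[(b - k.+1%:R * eps), (b + k.+1%:R * eps)]%classic)).
  apply: le_measure; rewrite ?inE//; first exact: (measurable_section v i (borel_slab _ _ _)).
  move=> t /=; rewrite in_itv /= -ler_distl => tS.
  rewrite -(ler_pM2r ai) -normrM; apply: (@le_trans _ _ (eps * \sum_j `|a j|)); last first.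
    by rewrite -mulrA mulrCA ler_pM2l.
  apply: le_trans tS; rewrite (bigD1 i)//= mxE eqxx mulrBl /b divfK// opprB addrA.
  rewrite le_eqVlt; apply/orP; left; apply/eqP; congr `|_|.
  congr (_ + _ - _); apply: eq_bigr => j ji.
  by rewrite mxE (negPf ji).
rewrite lebesgue_measure_itv/= lte_fin; case: ifP => _; last by rewrite lee_fin mulr_ge0.
by rewrite -EFinB lee_fin; lra.
Qed.

(** Moving [a] slightly towards an interior point [u] makes it interior; [l] is small enough for
    this shift to cost less than [r - eps] in every coordinate. *)
Lemma enlargement_interior (A : set 'rV[R]_k.+1) (eps r : R) :
  convex_subset A -> A° !=set0 -> 0 < eps < r ->
  enlarge A eps `\` A `<=` thicken A° r k.+1 `\` A°.
Proof.
move=> cA [u Au] /andP[e0 er] _ [[a Aa [b /= be <-]] nA]; split; last first.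
  by move=> /interior_subset.
pose K := 1 + \sum_j `|a ord0 j - u ord0 j|.
have K0 : 0 < K by rewrite ltr_pwDl// sumr_ge0.
pose l := Num.min 1 ((r - eps) / K).
have l0 : 0 < l by rewrite lt_min ltr01 divr_gt0// subr_gt0.
exists ((1 - l) *: a + l *: u).
  by apply: convex_interior_mix => //; rewrite l0 ge_min lexx.
move=> j; rewrite ltn_ord !mxE.
have -> : a ord0 j + b ord0 j - ((1 - l) * a ord0 j + l * u ord0 j) =
  b ord0 j + l * (a ord0 j - u ord0 j) by ring.
apply: le_lt_trans (ler_normD _ _) _; rewrite normrM gtr0_norm//.
have aK : `|a ord0 j - u ord0 j| < K.
  by rewrite /K (bigD1 j)//= addrCA ltrDl ltr_wpDr// sumr_ge0.
have lK : l * `|a ord0 j - u ord0 j| < r - eps.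
  apply: (@lt_le_trans _ _ (l * K)); first by rewrite ltr_pM2l.
  by rewrite -ler_pdivlMr// ge_min lexx orbT.
have := le_trans (enorm_ge b j) be; lra.
Qed.

Lemma enlargement_slab (A : set 'rV[R]_k.+1) (eps c : R) (a : 'I_k.+1 -> R) :
  (forall x : 'rV[R]_k.+1, A x -> \sum_i x ord0 i * a i = c) ->
  enlarge A eps `<=`
  [set x : 'rV[R]_k.+1 | `|\sum_i x ord0 i * a i - c| <= eps * \sum_i `|a i|].
Proof.
move=> Ac _ [x Ax [b /= be <-]].
have -> : \sum_i (x + b) ord0 i * a i - c = \sum_i b ord0 i * a i.
  rewrite -(Ac _ Ax) -sumrB; apply: eq_bigr => i _; rewrite mxE; ring.
apply: le_trans (ler_norm_sum _ _ _) _; rewrite mulr_sumr; apply: ler_sum => i _.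
by rewrite normrM ler_wpM2r// (le_trans (enorm_ge b i)).
Qed.

Lemma dmeasure_enlargement_le (A : set 'rV[R]_k.+1) (eps : R) :
  convex_subset A -> 0 < eps ->
  (dmeasure f (enlarge A eps `\` A) <= (Num.sqrt 2 * k.+1%:R * eps)%:E)%E.
Proof.
move=> cA e0; have s0 : 0 < Num.sqrt 2 :> R by rewrite sqrtr_gt0.
have s2 : Num.sqrt 2 * Num.sqrt 2 = 2 :> R by rewrite -expr2 sqr_sqrtr.
have E (t : R) : 2 * t / Num.sqrt 2 = Num.sqrt 2 * t.
  by apply: (canLR (mulfK _)); rewrite ?gt_eqF// mulrAC s2.
have [A0|/nonemptyPn A0] := pselect (A !=set0); last first.
  apply: (@le_trans _ _ (iint k.+1 (fun=> 0%E))).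
    rewrite dmeasureE; apply: le_iint => s; first by rewrite lee_fin mulr_ge0 ?lcf.1.
    move=> _; rewrite indicE memNset ?mul0r// A0 => -[[a]].
    by [].
  by rewrite iint0 lee_fin mulr_ge0 ?ltW// mulr_gt0.
case: A0 => x0 Ax0.
have [iA|[a [c [a0 Ac]]]] := convex_interior_or_hyperplane cA Ax0; last first.
  apply: (@le_trans _ _ (dmeasure f
      [set x : 'rV[R]_k.+1 | `|\sum_i x ord0 i * a i - c| <= eps * \sum_i `|a i|]%R)).
    by apply: le_dmeasure; apply: subset_trans (@subDsetl _ _ _) _; exact: enlargement_slab.
  by apply: le_trans (dmeasure_slab_le _ e0 a0) _; rewrite E mulrA.
apply/lee_addgt0Pr => e' e'0.
(* Chosen so that [sqrt 2 * k.+1 * r] exceeds the target by exactly [e']. *)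
pose r := eps + e' / (Num.sqrt 2 * k.+1%:R).
have re : eps < r by rewrite ltrDl divr_gt0// mulr_gt0.
have r0 : 0 < r by exact: lt_trans re.
apply: (@le_trans _ _ (dmeasure f (thicken A° r k.+1 `\` A°))).
  by apply: le_dmeasure; apply: enlargement_interior => //; rewrite e0.
apply: le_trans (dmeasure_thicken r0 _ _ (leqnn _)) _.
- exact: open_interior.
- exact: convex_interior.
rewrite -EFinD lee_fin E /r le_eqVlt; apply/orP; left; apply/eqP.
by field; rewrite gt_eqF//= pnatr_eq0.
Qed.

End boundary.

End line_sections.

Theorem theorem5p7 (R : realType) (n : nat) (f : 'rV[R]_n -> R) :
  prob_density f -> log_concave_fun f -> isotropic f -> unconditional f ->
  continuous f ->
  [/\ (forall (A : set 'rV[R]_n) (eps : R), convex_subset A -> 0 < eps ->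
         (dmeasure f (enlarge A eps `\` A) <= (Num.sqrt 2 * n%:R * eps)%:E)%E),
      (forall A : set 'rV[R]_n, convex_subset A ->
         (surface_measure f A <= (Num.sqrt 2 * n%:R)%:E)%E)
    & (Gamma f <= (Num.sqrt 2 * n%:R)%:E)%E].
Proof.
move=> pf lcf isof uf cf.
have enl (A : set 'rV[R]_n) (eps : R) : convex_subset A -> 0 < eps ->
    (dmeasure f (enlarge A eps `\` A) <= (Num.sqrt 2 * n%:R * eps)%:E)%E.
  case: n f pf lcf isof uf cf A eps => [|k] f pf lcf isof uf cf A eps cA e0.
    (* In dimension 0 there is one point; if it is in the enlargement, it is already in [A], so the
       difference is empty. *)
    rewrite /dmeasure /Rn_int /= mulr0 mul0r indicE memNset ?mul0r//.
    move=> [[a Aa _] nA]; apply: nA.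
    by congr (A _) : Aa; apply/rowP => -[].
  exact: dmeasure_enlargement_le.
have surf (A : set 'rV[R]_n) : convex_subset A ->
    (surface_measure f A <= (Num.sqrt 2 * n%:R)%:E)%E.
  move=> cA; apply: ge_ereal_sup => _ [d /= d0 <-].
  (* The infimum over [0 < e < d] is at most the value at [d / 2], where the bound on enlargements
     applies. *)
  have d2 : 0 < d / 2 by rewrite divr_gt0.
  apply: (@le_trans _ _ (dmeasure f (enlarge A (d / 2) `\` A) * ((d / 2)^-1)%:E)%E).
    apply: ereal_inf_lbound; exists (d / 2) => //=; rewrite d2 ltr_pdivrMr// ltr_pMr//.
    by rewrite ltr1n.
  rewrite -(mulfK (lt0r_neq0 d2) (Num.sqrt 2 * n%:R)) EFinM.
  by apply: lee_wpmul2r; [rewrite lee_fin invr_ge0 ltW|exact: enl].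
split => //.
by apply: ge_ereal_sup => _ [A [cA _] <-]; exact: surf.
Qed.
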